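(* Let $\mathcal H$ be a Halton sequence in $[0,1)^d$, $d\ge1$, in pairwise coprime bases $b_1,\dots,b_d\ge2$. Apply a single full Owen scrambling to each coordinate in its respective base, independently across coordinates, and let $\widetilde P_N$ denote the first $N$ scrambled points. Then, as $N\to\infty$, $$ R_\infty(\widetilde P_N)=\Omega_{\mathbb P}\left(N^{-3/(2d)}(\log N)^{-(d-1)/(2d)}\right), \qquad R_\infty(\widetilde P_N)=O_{\mathbb P}\left(N^{-3/(2d)}\right), $$ $$ h_\infty(\widetilde P_N)\asymp N^{-1/d}, $$ $$ \rho_\infty(\widetilde P_N)=\Omega_{\mathbb P}\left(N^{1/(2d)}\right), \qquad \rho_\infty(\widetilde P_N)=O_{\mathbb P}\left(N^{1/(2d)}(\log N)^{(d-1)/(2d)}\right), $$ with constants depending only on $d$ and the bases. Moreover, almost surely, $$ \frac{\log R_\infty(\widetilde P_N)}{\log N}\longrightarrow-\frac{3}{2d}, \qquad \frac{\log\rho_\infty(\widetilde P_N)}{\log N}\longrightarrow\frac1{2d} $$ as $N\to\infty$; in particular, the scrambled sequence is almost surely not quasi-uniform.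
   Context: Halton sequence in bases $b_1,\dots,b_d$: the $n$-th point ($n\ge0$) has $j$-th coordinate $\sum_{i\ge0}n_i b_j^{-i-1}$, where $n=\sum_{i\ge0}n_ib_j^i$ is the base-$b_j$ expansion of $n$. Full Owen scrambling of coordinate $j$ in base $b_j$: for each finite digit prefix $a_1\cdots a_{r-1}\in\{0,\dots,b_j-1\}^{r-1}$ ($r\ge1$), choose a uniform random permutation $\pi_{j,a_1\cdots a_{r-1}}$ of $\{0,\dots,b_j-1\}$, all mutually independent (over prefixes and coordinates). The $j$-th coordinate with base-$b_j$ digits $(a_r)_{r\ge1}$ (regular expansion) is replaced by the number with base-$b_j$ digits $\widetilde a_r=\pi_{j,a_1\cdots a_{r-1}}(a_r)$. A single scrambling uses the same permutations for all points of the sequence. For an $N$-point multiset $P=(\boldsymbol x_n)_{0\le n<N}$ in $[0,1]^d$ with $N\ge2$: $R_\infty(P)=\min_{n<n'}\|\boldsymbol x_n-\boldsymbol x_{n'}\|_\infty$, $h_\infty(P)=\sup_{\boldsymbol z\in[0,1]^d}\min_{n}\|\boldsymbol z-\boldsymbol x_n\|_\infty$, $\rho_\infty(P)=2h_\infty(P)/R_\infty(P)$ ($=\infty$ if $R_\infty(P)=0$). A sequence is quasi-uniform if the supremum over $N\ge2$ of $\rho_\infty$ of its first $N$ points is finite. Probabilistic order: $X_N=O_{\mathbb P}(a_N)$ means that for every $\varepsilon>0$ there are $C_\varepsilon>0$ and $N_\varepsilon$ with $\mathbb P(|X_N|>C_\varepsilon a_N)\le\varepsilon$ for all $N\ge N_\varepsilon$;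 for positive $X_N$, $X_N=\Omega_{\mathbb P}(a_N)$ means $a_N/X_N=O_{\mathbb P}(1)$. $f_N\asymp g_N$ means two-sided bounds with positive constants. *)

(* Defs.v *)
From HB Require Import structures.
From mathcomp Require Import all_boot all_order all_algebra perm.
From mathcomp Require Import all_classical all_reals all_analysis.

Set Implicit Arguments.
Unset Strict Implicit.
Unset Printing Implicit Defensive.

Import Order.TTheory GRing.Theory Num.Theory.
Import numFieldNormedType.Exports.

Local Open Scope classical_set_scope.
Local Open Scope ring_scope.

(* Digits are indexed from 0: [a r] is the coefficient of b^-(r+1). *)
Definition digits_value (R : realType) (b : nat) (a : nat -> nat) : R :=
  limn (series (fun r => (a r)%:R / b%:R ^+ r.+1 : R)).

Definition halton (R : realType) (d : nat) (b : 'I_d -> nat) (n : nat) :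
    'rV[R]_d :=
  \row_(j < d) digits_value R (b j) (fun i => (n %/ b j ^ i) %% b j)%N.

(* Digits of the regular base-b expansion of x >= 0, that is, the one which does
   not end in an infinite run of b - 1. *)
Definition regular_digit (R : realType) (b : nat) (hb : (0 < b)%N) (x : R)
    (r : nat) : 'I_b :=
  Ordinal (ltn_pmod (Num.truncn (x * b%:R ^+ r.+1)) hb).

(* [sigma [:: a_1; ...; a_r]] is the permutation applied to the digit that
   follows the prefix a_1 ... a_r. *)
Definition owen_coordinate (R : realType) (b : nat) (hb : (0 < b)%N)
    (sigma : seq 'I_b -> {perm 'I_b}) (x : R) : R :=
  digits_value R b (fun r =>
    sigma (mkseq (regular_digit hb x) r) (regular_digit hb x r) : nat).

Definition owen_scrambling (R : realType) (d : nat) (b : 'I_d -> nat)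
    (hb : forall j, (1 < b j)%N)
    (sigma : forall j, seq 'I_(b j) -> {perm 'I_(b j)}) (x : 'rV[R]_d) :
    'rV[R]_d :=
  \row_(j < d) owen_coordinate (ltnW (hb j)) (sigma j) (x 0 j).

Definition mutually_independent (R : realType) (disp : measure_display)
    (T : measurableType disp) (P : probability T R) (K : eqType)
    (S : K -> finType) (X : forall k, T -> S k) : Prop :=
  forall (s : seq K) (A : forall k, {set S k}), uniq s ->
    P [set t | forall k, k \in s -> X k t \in A k] =
    (\prod_(k <- s) P [set t | X k t \in A k])%E.

(* The family is indexed by all pairs (coordinate, finite digit prefix), so that
   mutual independence is over prefixes and coordinates at once. *)
Definition owen_permutations (R : realType) (disp : measure_display)
    (T : measurableType disp) (P : probability T R) (d : nat) (b : 'I_d -> nat)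
    (pi : forall j, seq 'I_(b j) -> T -> {perm 'I_(b j)}) : Prop :=
  [/\ forall j a s, measurable [set t | pi j a t = s],
      forall j a s, P [set t | pi j a t = s] = (((b j)`!%:R)^-1)%:E
    & mutually_independent P
        (fun (k : {j : 'I_d & seq 'I_(b j)}) (t : T) =>
           pi (tag k) (tagged k) t)].

Definition scrambled_halton (R : realType) (T : Type) (d : nat)
    (b : 'I_d -> nat) (hb : forall j, (1 < b j)%N)
    (pi : forall j, seq 'I_(b j) -> T -> {perm 'I_(b j)}) (t : T) (n : nat) :
    'rV[R]_d :=
  owen_scrambling hb (fun j a => pi j a t) (halton R b n).

(* The norm `| _ | on row vectors is the sup norm.  In the three quantities
   below, N-point multisets are the first N terms of a sequence. *)

(* For N >= 2 the set is finite and nonempty, so the infimum is a minimum. *)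
Definition separation (R : realType) (d : nat) (x : nat -> 'rV[R]_d)
    (N : nat) : R :=
  inf [set r | exists n n', [/\ (n < n')%N, (n' < N)%N & r = `|x n - x n'|]].

(* For N >= 1 the inner infimum is a minimum. *)
Definition covering_radius (R : realType) (d : nat) (x : nat -> 'rV[R]_d)
    (N : nat) : R :=
  sup [set r | exists2 z : 'rV[R]_d, (forall j, 0 <= z 0 j <= 1) &
               r = inf [set `|z - x n| | n in [set n | (n < N)%N]]].

Definition mesh_ratio (R : realType) (d : nat) (x : nat -> 'rV[R]_d)
    (N : nat) : \bar R :=
  if separation x N == 0 then +oo%E
  else (2 * covering_radius x N / separation x N)%:E.

Definition quasi_uniform (R : realType) (d : nat) (x : nat -> 'rV[R]_d) :
    Prop :=
  (ereal_sup [set mesh_ratio x N | N in [set N | (2 <= N)%N]] < +oo)%E.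

(* X_N = O_P(a_N), with the constants C_eps = C eps and N_eps = M eps explicit
   so that one can express what they are allowed to depend on. *)
Definition bigOP_with (R : realType) (C : R -> R) (M : R -> nat)
    (disp : measure_display) (T : measurableType disp) (P : probability T R)
    (X : nat -> T -> \bar R) (a : nat -> R) : Prop :=
  forall eps : R, 0 < eps ->
    0 < C eps /\
    forall N, (M eps <= N)%N ->
      (P [set t | (C eps * a N)%:E < `|X N t|] <= eps%:E)%E.

(* Division in \bar R, where 0^-1 = +oo and +oo^-1 = 0. *)
Definition bigOmegaP_with (R : realType) (C : R -> R) (M : R -> nat)
    (disp : measure_display) (T : measurableType disp) (P : probability T R)
    (X : nat -> T -> \bar R) (a : nat -> R) : Prop :=
  bigOP_with C M P (fun N t => (a N)%:E / X N t)%E (fun=> 1).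

(* Main.v *)
Require Import Defs.
From HB Require Import structures.
From mathcomp Require Import all_boot all_order all_algebra perm.
From mathcomp Require Import all_classical all_reals all_analysis.
From mathcomp Require Import measurable_realfun.
From mathcomp Require Import zify ring lra.
Import Order.TTheory GRing.Theory Num.Theory.
Import numFieldNormedType.Exports.
Local Open Scope classical_set_scope.
Local Open Scope ring_scope.

Set Implicit Arguments.
Unset Strict Implicit.
Unset Printing Implicit Defensive.

(** Let the indices n and n' share exactly k_j digits in base b_j, for each
    coordinate j. Scrambling preserves this: the scrambled coordinates share k_j
    digits and then differ, and their later digits are independent and uniform,
    because they are read off permutations attached to different prefixes. Two
    such numbers are at distance at most r only if, after two adjacent digits,
    one of them goes on with digits b_j - 1 and the other one with digits 0, as
    long as b_j ^ - i exceeds r ([close_digits]). This costs both numbers about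
    log (1 / (r b_j ^ k_j)) digits in base b_j, so that the pair is within r
    with probability of order prod_j (r b_j ^ k_j) ^ 2.

    Lower bound on the separation. A union bound over the pairs of indices below
    N sums r ^ (2 d) D ^ 2 with D = prod_j b_j ^ k_j, where D divides n' - n and
    D < N, so that at most 2 N ^ 2 / D pairs have a given D. This leaves
    N ^ 2 r ^ (2 d) times the sum of all such D < N, which is at most of order
    N (log N) ^ (d - 1): summing over the last exponent is geometric
    ([sum_products_lt], [Pr_separation_lt]). The result is small when r is small
    compared to N ^ (- 3 / (2 d)) (log N) ^ (- (d - 1) / (2 d)).

    Upper bound. Let m = prod_j b_j ^ k_j with b_j ^ k_j of order N ^ (1 / d)
    and consider the m pairs (n, n + m), n < m. By the Chinese remainder
    theorem these n run through all the combinations of prefixes, and two pairs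
    are independent in each coordinate where their prefixes differ. Hence the
    number of close pairs has a variance which, relative to the squared mean, is
    at most prod_j (1 + 1 / (b_j ^ k_j q_j)) - 1, where q_j is the probability
    of being close in coordinate j, of order (r b_j ^ k_j) ^ 2 if this is at
    most 1 ([Pr_no_close_pair]). By Chebyshev's inequality a close pair exists
    with high probability as soon as r is large compared to N ^ (- 3 / (2 d))
    ([Pr_separation_gt]).

    Both tails decay like a power of N if r is off by a power of N, so that the
    Borel-Cantelli lemma along N = 2 ^ i and the monotonicity of the separation
    give the almost sure exponent. The covering radius is deterministic up to
    constants ([covering_radius_bounds]): scrambling permutes the elementary
    boxes, so that the first prod_j b_j ^ k_j points meet each of them once,
    and N points cannot be close to all the centres of more than N boxes. The
    mesh ratio is the quotient of the two. *)

(** * Digit expansions *)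

(** The integer written a 0, ..., a (i - 1) in base b, most significant digit
    first; it numbers the elementary interval of level i containing the number
    with digits a. *)
Fixpoint digits_int (b : nat) (a : nat -> nat) (i : nat) : nat :=
  if i is i'.+1 then (digits_int b a i' * b + a i')%N else 0%N.

Section Horner.
Local Open Scope nat_scope.
Context (b : nat).

Lemma eq_digits_int (a a' : nat -> nat) i :
  (forall r, r < i -> a r = a' r) -> digits_int b a i = digits_int b a' i.
Proof.
elim: i => //= i IH h; rewrite IH => [|r ri]; last exact: h (ltnW _).
by rewrite h.
Qed.

Lemma digits_int_window (a : nat -> nat) (ab : forall r, a r < b) m p :
  digits_int b a m * b ^ p <= digits_int b a (m + p) < (digits_int b a m).+1 * b
    ^ p.
Proof.
elim: p => [|p /andP[l u]]; first by rewrite addn0 expn0 !muln1 ltnS !leqnn.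
by rewrite addnS /= expnS; have := ab (m + p); nia.
Qed.

Lemma digits_int_lt (a : nat -> nat) (ab : forall r, a r < b) i :
  digits_int b a i < b ^ i.
Proof. by have /andP[_] := digits_int_window ab 0 i; rewrite add0n mul1n. Qed.

Lemma digits_int_inj (a a' : nat -> nat) i :
  (forall r, a r < b) -> (forall r, a' r < b) ->
  digits_int b a i = digits_int b a' i -> forall r, r < i -> a r = a' r.
Proof.
move=> ab ab'; elim: i => // i IH /= e.
have ei : a i = a' i.
  have := congr1 (modn^~ b) e.
  by rewrite !modnMDl !modn_small.
move=> r; rewrite ltnS leq_eqVlt => /orP[/eqP -> //|]; apply: IH.
by have := ab i; nia.
Qed.

(** Two expansions whose integer parts differ by exactly one at a late stage,
    and already differ earlier, are separated by a carry: in between, one of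
    them only has digits b - 1 and the other only digits 0. *)
Lemma digits_int_carry (a a' : nat -> nat) k l :
  (forall r, a r < b) -> (forall r, a' r < b) ->
  digits_int b a k <> digits_int b a' k ->
  (digits_int b a (k + l)).+1 = digits_int b a' (k + l) ->
  (digits_int b a k).+1 = digits_int b a' k /\
  forall r, k <= r < k + l -> a r = b.-1 /\ a' r = 0.
Proof.
move=> ab ab' ne; elim: l => [|l IH] /=.
  by rewrite addn0 => e; split=> // r; lia.
rewrite addnS /= => e.
have ne' : digits_int b a (k + l) <> digits_int b a' (k + l).
  by move=> /(digits_int_inj ab ab') h; apply: ne; apply: eq_digits_int => r rk;
     apply: h; lia.
have := ab (k + l); have := ab' (k + l) => h h'.
have e1 : (digits_int b a (k + l)).+1 = digits_int b a' (k + l) by nia.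
have e2 : a (k + l) = b.-1 /\ a' (k + l) = 0 by nia.
have [f1 f2] := IH e1; split=> // r; rewrite ltnS => /andP[kr].
by rewrite leq_eqVlt => /orP[/eqP -> //|rl]; apply: f2; rewrite kr.
Qed.

Lemma digits_int_carry_intro (a a' : nat -> nat) k l :
  0 < b -> (digits_int b a k).+1 = digits_int b a' k ->
  (forall r, k <= r < k + l -> a r = b.-1 /\ a' r = 0) ->
  (digits_int b a (k + l)).+1 = digits_int b a' (k + l).
Proof.
move=> b0 e; elim: l => [|l IH] h; first by rewrite addn0.
rewrite addnS /= -IH => [|r rl]; last by apply: h; lia.
have [-> ->] : a (k + l) = b.-1 /\ a' (k + l) = 0 by apply: h; lia.
nia.
Qed.

Lemma modn_expnS n i :
  n %% b ^ i.+1 = n %/ b ^ i %% b * b ^ i + n %% b ^ i.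
Proof.
have [->|b0] := posnP b; first by case: i => [|i];
  rewrite ?expn0 ?expn1 ?modn1 ?modn0 ?divn1 ?muln1 ?addn0 // !exp0n // !modn0
    !muln0.
rewrite modn_divl -expnS [LHS](divn_eq _ (b ^ i)); congr (_ + _).
by rewrite modn_dvdm // expnS dvdn_mull.
Qed.

Lemma eqmod_digits n n' i :
  (n = n' %[mod b ^ i]) <->
  (forall r, r < i -> n %/ b ^ r %% b = n' %/ b ^ r %% b).
Proof.
have [->|b0] := posnP b.
  case: i => [|i]; first by rewrite expn0 !modn1.
  rewrite exp0n // !modn0; split=> [-> //|/(_ 0 isT)].
  by rewrite expn0 !divn1 !modn0.
elim: i => [|i IH]; first by rewrite expn0 !modn1.
rewrite !modn_expnS; split=> [e r|h].
  have e0 : n = n' %[mod b ^ i].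
    by have := congr1 (modn^~ (b ^ i)) e; rewrite !modnMDl !modn_mod.
  rewrite ltnS leq_eqVlt => /orP[/eqP ->|]; last by apply: (IH.1 e0).
  move: e; rewrite e0 => /addIn /eqP; rewrite eqn_pmul2r ?expn_gt0 ?b0 //.
  by move=> /eqP.
rewrite h //; congr (_ + _); apply/IH => r ri; exact: h (ltnW _).
Qed.

End Horner.

Section DigitsValue.
Context (R : realType) (b : nat) (hb : (1 < b)%N).
Local Notation bR := (b%:R : R).

Let b0 : 0 < bR. Proof. by rewrite ltr0n ltnW. Qed.
Let bi0 i : 0 < bR ^+ i. Proof. by rewrite exprn_gt0. Qed.

Lemma series_digits_int (a : nat -> nat) i :
  series (fun r => (a r)%:R / bR ^+ r.+1 : R) i = (digits_int b a i)%:R / bR ^+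
    i.
Proof.
elim: i => [|i IH]; first by rewrite /series /= big_geq // mul0r.
rewrite seriesSr IH /= natrD natrM exprS mulrDl; congr (_ + _).
by rewrite invfM mulrA -(mulrA _ bR) divff ?gt_eqF // mulr1.
Qed.

Lemma digits_int_windowR (a : nat -> nat) (ab : forall r, (a r < b)%N) i p :
  (digits_int b a i)%:R / bR ^+ i <= (digits_int b a (i + p))%:R / bR ^+ (i + p)
    /\
  ((digits_int b a (i + p)).+1)%:R / bR ^+ (i + p) <=
    ((digits_int b a i).+1)%:R / bR ^+ i.
Proof.
have /andP[l u] := digits_int_window ab i p.
have E (x : R) : x / bR ^+ i = x * bR ^+ p / bR ^+ (i + p).
  by rewrite exprD invfM mulrA -!mulrA (mulrC (bR ^- i)) !mulrA mulfK ?gt_eqF.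
by rewrite !E !ler_pM2r ?invr_gt0 // -!natrX -!natrM !ler_nat l u.
Qed.

Lemma cvg_digits_value (a : nat -> nat) (ab : forall r, (a r < b)%N) :
  series (fun r => (a r)%:R / bR ^+ r.+1 : R) @ \oo --> digits_value R b a.
Proof.
apply: nondecreasing_is_cvgn.
  move=> i j ij; rewrite !series_digits_int -(subnKC ij).
  by have [] := digits_int_windowR ab i (j - i).
exists 1 => _ [i _ <-]; rewrite series_digits_int ler_pdivrMr // mul1r -natrX.
by rewrite ler_nat ltnW // digits_int_lt.
Qed.

(** Both bounds can be attained: a sequence of digits may end in an infinite run
    of b - 1, and scrambling can produce such sequences. *)
Lemma digits_value_window (a : nat -> nat) (ab : forall r, (a r < b)%N) i :
  (digits_int b a i)%:R / bR ^+ i <= digits_value R b a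
    <= ((digits_int b a i).+1)%:R / bR ^+ i.
Proof.
have c := cvg_digits_value ab.
apply/andP; split.
  apply: (cvgr_to_ge c).
  near=> n; rewrite series_digits_int.
  have ij : (i <= n)%N by near: n; exact: nbhs_infty_ge.
  by rewrite -(subnKC ij); have [] := digits_int_windowR ab i (n - i).
apply: (cvgr_to_le c).
near=> n; rewrite series_digits_int.
have ij : (i <= n)%N by near: n; exact: nbhs_infty_ge.
apply: (@le_trans _ _ ((digits_int b a n).+1%:R / bR ^+ n)).
  by rewrite ler_pM2r ?invr_gt0 // ler_nat.
by rewrite -(subnKC ij); have [] := digits_int_windowR ab i (n - i).
Unshelve. all: end_near. Qed.

Lemma digits_value_itv (a : nat -> nat) (ab : forall r, (a r < b)%N) :
  0 <= digits_value R b a <= 1.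
Proof. by have := digits_value_window ab 0; rewrite /= expr0 !divr1. Qed.

Lemma digits_value_finite (a : nat -> nat) L :
  (forall r, (L <= r)%N -> a r = 0%N) ->
  digits_value R b a = (digits_int b a L)%:R / bR ^+ L.
Proof.
move=> aL; apply: cvg_lim => //.
apply: cvg_near_cst; near=> n.
have ij : (L <= n)%N by near: n; exact: nbhs_infty_ge.
rewrite series_digits_int -(subnKC ij); elim: (n - L)%N => [|p IH].
  by rewrite addn0.
rewrite addnS /= aL ?leq_addr // addn0 natrM exprS invfM mulrA -(mulrA _ bR).
by rewrite divff ?gt_eqF // mulr1.
Unshelve. all: end_near. Qed.

End DigitsValue.

Section Scrambling.
Context (b : nat) (hb : (0 < b)%N).

Definition digit (n i : nat) : 'I_b := Ordinal (ltn_pmod (n %/ b ^ i) hb).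

Definition prefix_digits (n i : nat) : seq 'I_b := mkseq (digit n) i.

Lemma eq_digit n n' i : (digit n i = digit n' i) <->
  (n %/ b ^ i %% b = n' %/ b ^ i %% b)%N.
Proof. by split=> [/(congr1 val) //|e]; apply: val_inj. Qed.

Lemma eq_prefix_digits n n' i :
  (prefix_digits n i = prefix_digits n' i) <-> (n = n' %[mod b ^ i])%N.
Proof.
split=> [e|/eqmod_digits h].
  apply/eqmod_digits => r ri; apply/eq_digit.
  by have := congr1 (fun s => nth (digit n 0) s r) e; rewrite !nth_mkseq.
apply: (@eq_from_nth _ (digit n 0)); rewrite !size_mkseq // => r ri.
by rewrite !nth_mkseq //; apply/eq_digit/h.
Qed.

Context (sigma : seq 'I_b -> {perm 'I_b}).

Definition scrambled_digit (n i : nat) : 'I_b :=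
  sigma (prefix_digits n i) (digit n i).

Local Notation cell n i := (digits_int b (scrambled_digit n) i).

(** Scrambling permutes the elementary intervals of every level, because the
    permutations along a common prefix coincide and each of them is
    injective. *)
Lemma eq_cell n n' i : (cell n i = cell n' i) <-> (n = n' %[mod b ^ i])%N.
Proof.
split.
  move=> /digits_int_inj h; apply/eqmod_digits.
  have {}h r : (r < i)%N -> scrambled_digit n r = scrambled_digit n' r.
    by move=> ri; apply: val_inj; apply: h.
  elim: i h => // i IH h r; rewrite ltnS leq_eqVlt => /orP[/eqP ->|ri].
    have /eq_prefix_digits e : (n = n' %[mod b ^ i])%N.
      by apply/eqmod_digits; apply: IH => s si; apply: h (ltnW _).
    by have := h i (ltnSn i); rewrite /scrambled_digit e => /perm_inj /eq_digit.
  by apply: IH => // s si; apply: h (ltnW _).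
move=> e; apply: eq_digits_int => r ri; rewrite /scrambled_digit.
have /eq_prefix_digits -> : (n = n' %[mod b ^ r])%N.
  by apply/eqmod_digits => s sr; move/eqmod_digits: e; apply; apply: ltn_trans
    ri.
by congr (val (sigma _ _)); apply/eq_digit; move/eqmod_digits: e; apply.
Qed.

End Scrambling.

Section Halton.
Context (R : realType).

(** The expansion of a Halton coordinate is finite, hence regular: the digits
    that the scrambling reads are those of the index n. *)
Lemma regular_digit_halton (b : nat) (hb : (1 < b)%N) (n r : nat) :
  regular_digit (ltnW hb)
    (digits_value R b (fun i => n %/ b ^ i %% b)%N) r = digit (ltnW hb) n r.
Proof.
pose a := (fun i => n %/ b ^ i %% b)%N.
have ab i : (a i < b)%N by rewrite ltn_pmod // ltnW.
have bi0 i : 0 < (b%:R : R) ^+ i by rewrite exprn_gt0 // ltr0n ltnW.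
apply: val_inj; rewrite /= (@digits_value_finite _ _ hb a (r.+1 + n)); last
  first.
  move=> i ni; rewrite /a divn_small ?mod0n //.
  by apply: leq_trans (ltn_expl n hb) _; rewrite leq_exp2l //; lia.
set H := digits_int b a (r.+1 + n).
have -> : Num.truncn (H%:R / b%:R ^+ (r.+1 + n) * b%:R ^+ r.+1 : R)
    = digits_int b a r.+1.
  have /andP[l u] := digits_int_window ab r.+1 n.
  have -> : H%:R / b%:R ^+ (r.+1 + n) * b%:R ^+ r.+1 = H%:R / b%:R ^+ n :> R.
    by rewrite exprD invfM mulrA mulrAC mulfVK // gt_eqF.
  apply: truncn_def; rewrite ler_pdivlMr // ltr_pdivrMr //.
  by rewrite -!natrX -!natrM ler_nat ltr_nat l u.
by rewrite /= modnMDl modn_small.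
Qed.

Lemma scrambled_haltonE (T : Type) (d : nat) (b : 'I_d -> nat)
    (hb : forall j, (1 < b j)%N)
    (pi : forall j, seq 'I_(b j) -> T -> {perm 'I_(b j)}) t n j :
  scrambled_halton R hb pi t n 0 j =
  digits_value R (b j) (fun i =>
    scrambled_digit (ltnW (hb j)) (fun a => pi j a t) n i : nat).
Proof.
rewrite /scrambled_halton /owen_scrambling !mxE /owen_coordinate.
congr (digits_value R _); apply/funext => i.
rewrite /scrambled_digit /prefix_digits regular_digit_halton.
congr (val (pi j _ t _)); apply: eq_mkseq => r; exact: regular_digit_halton.
Qed.

End Halton.

(** * Residues modulo pairwise coprime numbers *)

Section Residues.
Local Open Scope nat_scope.
Context (d : nat) (F : 'I_d -> nat)
  (cF : forall i j, i != j -> coprime (F i) (F j)).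

Lemma dvdn_prod_coprime m : (forall i, F i %| m) -> \prod_i F i %| m.
Proof.
move=> h; apply/unstable.Gauss_dvd_prod => //.
rewrite pairwise_map filter_predT.
have: uniq (index_enum 'I_d) by exact: index_enum_uniq.
rewrite uniq_pairwise; apply: sub_pairwise => i j /= ne; exact: cF.
Qed.

Lemma eqmod_prod_coprime n n' : n < \prod_i F i -> n' < \prod_i F i ->
  (forall i, n = n' %[mod F i]) -> n = n'.
Proof.
move=> hn hn' h; rewrite -(modn_small hn) -(modn_small hn').
wlog le : n n' hn hn' h / n' <= n.
  move=> W; case: (leqP n' n) => [|/ltnW] l; first exact: W.
  by apply/esym/W => // i; rewrite h.
apply/eqP; rewrite eqn_mod_dvd //; apply: dvdn_prod_coprime => i.
by rewrite -eqn_mod_dvd //; apply/eqP/h.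
Qed.

End Residues.

Lemma coprime_pow (d : nat) (b k : 'I_d -> nat) :
  (forall i j, i != j -> coprime (b i) (b j)) ->
  forall i j, i != j -> coprime (b i ^ k i) (b j ^ k j).
Proof. by move=> h i j ij; rewrite coprimeXl // coprimeXr // h. Qed.

(** * The sup norm and the two radii *)

Section SupNorm.
Context (R : realType) (d : nat).
Implicit Types (v : 'rV[R]_d).

Lemma norm_rV_le v (c : R) : 0 <= c ->
  (`|v| <= c) = [forall j, `|v 0 j| <= c].
Proof.
move=> c0; apply/idP/forallP => [h j|h].
  apply: le_trans h; rewrite /Num.norm /= mx_normrE.
  by apply: (le_bigmax _ (fun ij => `|v ij.1 ij.2|) (0, j)).
rewrite /Num.norm /= mx_normrE; apply/bigmax_leP; split => // -[i j] _ /=.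
by rewrite (ord1 i).
Qed.

Lemma norm_rV_lt v (c : R) : 0 < c ->
  (`|v| < c) = [forall j, `|v 0 j| < c].
Proof.
move=> c0; apply/idP/forallP => [h j|h].
  apply: le_lt_trans h; rewrite /Num.norm /= mx_normrE.
  by apply: (le_bigmax _ (fun ij => `|v ij.1 ij.2|) (0, j)).
rewrite /Num.norm /= mx_normrE; apply/bigmax_ltP; split => // -[i j] _ /=.
by rewrite (ord1 i).
Qed.

End SupNorm.

Section Radii.
Context (R : realType) (d : nat) (x : nat -> 'rV[R]_d).
Hypothesis x01 : forall n j, 0 <= x n 0 j <= 1.

Local Notation dist_to z N := (inf [set `|z - x n| | n in [set n | (n < N)%N]]).

Lemma dist_to_le (z : 'rV[R]_d) N n : (n < N)%N -> dist_to z N <= `|z - x n|.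
Proof.
move=> nN; apply: ge_inf; last by exists n.
by exists 0 => _ [m _ <-]; exact: normr_ge0.
Qed.

Lemma dist_to_ge (z : 'rV[R]_d) N c : (0 < N)%N ->
  (forall n, (n < N)%N -> c <= `|z - x n|) -> c <= dist_to z N.
Proof.
move=> N0 h; apply: lb_le_inf; first by exists `|z - x 0|, 0%N.
by move=> _ [n /= nN <-]; exact: h.
Qed.

Lemma covering_radius_le N c :
  (forall z : 'rV[R]_d, (forall j, 0 <= z 0 j <= 1) ->
    exists2 n, (n < N)%N & `|z - x n| <= c) ->
  covering_radius x N <= c.
Proof.
move=> h; apply: ge_sup.
  by exists (dist_to 0 N), 0 => // j; rewrite mxE lexx ler01.
move=> _ [z z01 ->]; have [n nN zn] := h z z01.
exact: le_trans (dist_to_le z nN) zn.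
Qed.

Lemma dist_le1 (z : 'rV[R]_d) n : (forall j, 0 <= z 0 j <= 1) ->
  `|z - x n| <= 1.
Proof.
move=> z01; rewrite norm_rV_le //; apply/forallP => j.
by rewrite !mxE ler_norml; have := z01 j; have := x01 n j; lra.
Qed.

Lemma dist_to_le_covering_radius N (z : 'rV[R]_d) : (0 < N)%N ->
  (forall j, 0 <= z 0 j <= 1) -> dist_to z N <= covering_radius x N.
Proof.
move=> N0 z01; apply: ub_le_sup; last by exists z.
exists 1 => _ [w w01 ->].
exact: le_trans (dist_to_le w N0) (dist_le1 0 w01).
Qed.

(** Cutting the cube into K^d > N boxes leaves a box without any point,
    whose centre is at distance at least 1 / (2 K) from all the points. *)
Lemma covering_radius_ge N K : (0 < N)%N -> (N < K ^ d)%N ->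
  (2 * K%:R)^-1 <= covering_radius x N.
Proof.
move=> N0 NK.
have K0 : (0 < K)%N by case: K NK N0 => //; case: (d) => [|e];
  rewrite ?expn0 ?exp0n //; lia.
pose K' := K.-1; have KK : K = K'.+1 by rewrite prednK.
have KR : 0 < K'.+1%:R :> R by [].
pose box (n : 'I_N) : {ffun 'I_d -> 'I_K'.+1} :=
  [ffun j => inord (Num.truncn (x n 0 j * K'.+1%:R))].
have [f fN] : exists f, f \notin codom box.
  apply/existsP; rewrite -negb_forall; apply/negP => /forallP h.
  have : (#|{: {ffun 'I_d -> 'I_K'.+1}}| <= #|'I_N|)%N.
    apply: leq_trans (leq_image_card box predT).
    by apply: subset_leq_card; apply/fintype.subsetP => f _; exact: h.
  by rewrite card_ffun !card_ord -KK leqNgt NK.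
pose z : 'rV[R]_d := \row_j (((f j)%:R + 2^-1) / K'.+1%:R).
have z01 j : 0 <= z 0 j <= 1.
  rewrite mxE ler_pdivlMr // ler_pdivrMr // mul0r mul1r.
  have : ((f j).+1%:R <= K'.+1%:R :> R) by rewrite ler_nat.
  have : (0 <= (f j)%:R :> R) by [].
  by rewrite -(natr1 (f j)); lra.
apply: le_trans (dist_to_le_covering_radius N0 z01).
apply: dist_to_ge => // n nN; rewrite leNgt; apply/negP => lt.
have c0 : 0 < (2 * K%:R : R)^-1 by rewrite invr_gt0 mulr_gt0 // KK.
move: lt; rewrite norm_rV_lt // => /forallP lt.
case/negP: fN; apply/codomP; exists (Ordinal nN); apply/ffunP => j.
rewrite ffunE /=; apply: val_inj => /=.
have -> : Num.truncn (x n 0 j * K'.+1%:R) = f j; last by rewrite inordK.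
have := lt j; rewrite !mxE KK invfM ltr_norml.
rewrite -(ltr_pM2r KR) -[X in _ && X](ltr_pM2r KR) mulNr mulrBl !divfK ?gt_eqF
  //.
move=> h.
apply: truncn_def; rewrite -natr1; lra.
Qed.

End Radii.

(** * Covering radius of the scrambled Halton sequence *)

Section Sequence.
Context (R : realType) (d : nat) (b : 'I_d -> nat)
  (hb : forall j, (1 < b j)%N)
  (hcop : forall i j, i != j -> coprime (b i) (b j))
  (T : Type) (pi : forall j, seq 'I_(b j) -> T -> {perm 'I_(b j)}) (t : T).

Local Notation x := (scrambled_halton R hb pi t).
Local Notation sdigit j :=
  (scrambled_digit (ltnW (hb j)) (fun a => @pi j a t)).

Lemma scrambled_halton_itv n j : 0 <= x n 0 j <= 1.
Proof.
by rewrite scrambled_haltonE; apply: (digits_value_itv _ (hb j)) => r.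
Qed.

(** The first prod_j b_j ^ k_j points meet each box of the corresponding
    partition exactly once: points in a common box have congruent indices, and
    there are as many boxes as indices. *)
Lemma cells_surj (k c : 'I_d -> nat) : (forall j, c j < b j ^ k j)%N ->
  exists2 n, (n < \prod_j b j ^ k j)%N &
    forall j, digits_int (b j) (sdigit j n) (k j) = c j.
Proof.
move=> cb; set m := (\prod_j b j ^ k j)%N.
have bk0 j : (0 < b j ^ k j)%N by rewrite expn_gt0 ltnW.
(* A common bound on the numbers of cells, which lets all the coordinates take
   their values in the same ordinal type. *)
pose L := (\sum_j b j ^ k j)%N.
have bL j : (b j ^ k j <= L.+1)%N.
  by apply: leqW; rewrite /L (bigD1 j) //= leq_addr.
pose cell (n : 'I_m) : {ffun 'I_d -> 'I_L.+1} :=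
  [ffun j => inord (digits_int (b j) (sdigit j n) (k j))].
have cellE (n : 'I_m) j : (cell n j : nat) = digits_int (b j) (sdigit j n) (k
  j).
  rewrite ffunE inordK //; apply: leq_trans (bL j).
  by apply: digits_int_lt => r.
have inj : injective cell.
  move=> n n' e; apply: val_inj.
  apply: (eqmod_prod_coprime (coprime_pow k hcop) (ltn_ord n) (ltn_ord n')) =>
    j.
  apply/(eq_cell (ltnW (hb j)) (fun a => @pi j a t)).
  by rewrite -!cellE e.
pose B : {set {ffun 'I_d -> 'I_L.+1}} :=
  finset (mem (family (fun j => [pred y : 'I_L.+1 | (y < b j ^ k j)%N]))).
have cB : #|B| = m.
  rewrite cardsE card_family foldrE big_map big_enum /=.
  apply: eq_bigr => j _.
  rewrite -sum1_card -(big_ord_widen _ (fun=> 1%N) (bL j)).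
  by rewrite sum1_card card_ord.
have : [ffun j => inord (c j)] \in B.
  rewrite inE; apply/familyP => j; rewrite inE ffunE inordK //.
  exact: leq_trans (bL j).
suff <- : imset cell (mem predT) = B.
  move=> /imsetP[n _ e]; exists n => // j.
  by rewrite -cellE -e ffunE inordK //; exact: leq_trans (bL j).
apply/eqP; rewrite eqEcard card_imset // card_ord cB leqnn andbT.
apply/fintype.subsetP => _ /imsetP[n _ ->]; rewrite inE; apply/familyP => j.
by rewrite inE cellE; apply: digits_int_lt => r.
Qed.

Lemma covering_radius_cells (k : 'I_d -> nat) N (c : R) :
  (\prod_j b j ^ k j <= N)%N -> (forall j, ((b j)%:R ^+ k j)^-1 <= c) ->
  0 <= c -> covering_radius x N <= c.
Proof.
move=> kN kc c0; apply: covering_radius_le => z z01.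
have bk0 j : (0 < b j ^ k j)%N by rewrite expn_gt0 ltnW.
have bR j : 0 < (b j)%:R ^+ k j :> R by rewrite -natrX ltr0n.
(* The minimum matters for z 0 j = 1, which is put in the last cell. *)
pose cz j := minn (Num.truncn (z 0 j * (b j)%:R ^+ k j)) (b j ^ k j).-1.
have czb j : (cz j < b j ^ k j)%N.
  by have := bk0 j; have := geq_minr (Num.truncn (z 0 j * (b j)%:R ^+ k j)) (b j
    ^ k j).-1; rewrite -/(cz j); lia.
have [n nm nc] := cells_surj czb.
exists n; first exact: leq_trans kN.
rewrite norm_rV_le //; apply/forallP => j; rewrite mxE [X in _ + X]mxE.
apply: le_trans (kc j).
have := digits_value_window R (hb j) (fun r => ltn_ord (sdigit j n r)) (k j).
rewrite -scrambled_haltonE nc ler_norml; set w := x n 0 j.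
have zB : (cz j)%:R / (b j)%:R ^+ k j <= z 0 j <= (cz j).+1%:R / (b j)%:R ^+ k
  j.
  rewrite ler_pdivrMr // ler_pdivlMr //.
  have y0 : 0 <= z 0 j * (b j)%:R ^+ k j.
    by rewrite mulr_ge0 // ?(ltW (bR j)) //; case/andP: (z01 j).
  have /andP[l u] := truncn_itv y0.
  have y1 : z 0 j * (b j)%:R ^+ k j <= ((b j ^ k j).-1).+1%:R.
    by rewrite prednK // natrX ler_piMl // ?(ltW (bR j)) //; case/andP: (z01 j).
  rewrite /cz /minn; case: ltnP => h; first by rewrite l ltW.
  by rewrite y1 andbT (le_trans _ l) // ler_nat.
move: zB; rewrite -(natr1 (cz j)) mulrDl mul1r; lra.
Qed.

End Sequence.

(** * Permutations with prescribed values *)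

Section PermAt.
Context (b : nat).
Implicit Types (u v : 'I_b).

Definition perm_at u v : {set {perm 'I_b}} := finset (fun s : {perm 'I_b} => s u
  == v).

Definition perm_at2 u v u' v' : {set {perm 'I_b}} :=
  perm_at u v :&: perm_at u' v'.

(** Composing with transpositions shows that the images v are equally likely. *)
Lemma card_perm_at u v : (#|perm_at u v| * b = b`!)%N.
Proof.
have cst v' : #|perm_at u v'| = #|perm_at u v|.
  rewrite -(card_imset (mem (perm_at u v)) (mulIg (tperm v v'))).
  apply: eq_card => s; rewrite !inE; apply/eqP/imsetP => [su|[r]].
    exists (s * tperm v v')%g; last by rewrite -mulgA tperm2 mulg1.
    by rewrite inE permM su tpermR.
  by rewrite inE => /eqP ru ->; rewrite permM ru tpermL.
have -> : (#|perm_at u v| * b = \sum_(v' : 'I_b) #|perm_at u v'|)%N.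
  by rewrite (eq_bigr _ (fun v' _ => cst v')) sum_nat_const card_ord mulnC.
transitivity #|[set: {perm 'I_b}]%SET|; last first.
  by rewrite cardsT card_Sn.
rewrite -sum1_card (partition_big (fun s : {perm 'I_b} => s u) predT) //=.
apply: eq_bigr => v' _; rewrite -sum1_card; apply: eq_bigl => s.
by rewrite !inE.
Qed.

Lemma exists_perm_at2 u v u' v' : u != u' -> v != v' ->
  exists s, s \in perm_at2 u v u' v'.
Proof.
move=> uu vv; pose w := tperm u v u'.
exists (tperm u v * tperm w v')%g; rewrite !inE !permM tpermL tpermL eqxx andbT.
rewrite tpermD // /w; last by rewrite eq_sym.
by rewrite -{2}(tpermL u v) (inj_eq perm_inj) eq_sym.
Qed.

(** Composing with a permutation that sends u2 to u1 and u2' to u1'. *)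
Lemma card_perm_at2 u1 u1' u2 u2' v v' : u1 != u1' -> u2 != u2' ->
  #|perm_at2 u1 v u1' v'| = #|perm_at2 u2 v u2' v'|.
Proof.
move=> n1 n2; have [r] := exists_perm_at2 n2 n1.
rewrite !inE => /andP[/eqP r1 /eqP r2].
rewrite -(card_imset (mem (perm_at2 u1 v u1' v')) (mulgI r)).
apply: eq_card => s; rewrite [RHS]inE; apply/imsetP/idP => [[s']|].
  by rewrite !inE => h ->; rewrite !permM r1 r2.
move=> h; exists (r^-1 * s)%g; last by rewrite mulgA mulgV mul1g.
by move: h; rewrite !inE !permM -r1 -r2 !permK.
Qed.

End PermAt.

(** * Probabilities of finitely many events *)

Section Probability.
Context (R : realType) (disp : measure_display) (T : measurableType disp)
  (P : probability T R).

Local Notation "'Pr' A" := (fine (P A)) (at level 10, A at level 8).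

Lemma PrE (A : set T) : measurable A -> P A = (Pr A)%:E.
Proof. by move=> mA; rewrite fineK // fin_num_measure. Qed.

Lemma Pr_le (A B : set T) : measurable A -> measurable B -> A `<=` B ->
  Pr A <= Pr B.
Proof.
move=> mA mB AB; rewrite -lee_fin -!PrE //.
by apply: le_measure => //; rewrite inE.
Qed.

Lemma Pr_le1 (A : set T) : measurable A -> Pr A <= 1.
Proof. by move=> mA; rewrite -lee_fin -PrE // probability_le1. Qed.

Lemma sum_option (I : finType) (F : option I -> R) :
  \sum_o F o = F None + \sum_i F (Some i).
Proof.
rewrite (bigD1 None) //= (reindex_omap Some id) /=; last by case.
by congr (_ + _); apply: eq_bigl => i; rewrite eqxx.
Qed.

(** Obtained by integrating the pointwise inequality; it yields both the union
    bound and the second moment bound. *)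
Lemma le_sum_Pr (I J : finType) (c : I -> R) (A : I -> set T)
    (e : J -> R) (B : J -> set T) :
  (forall i, 0 <= c i) -> (forall j, 0 <= e j) ->
  (forall i, measurable (A i)) -> (forall j, measurable (B j)) ->
  (forall t, \sum_i c i * \1_(A i) t <= \sum_j e j * \1_(B j) t) ->
  \sum_i c i * Pr (A i) <= \sum_j e j * Pr (B j).
Proof.
move=> c0 e0 mA mB le.
have key (K : finType) (f : K -> R) (D : K -> set T) : (forall k, 0 <= f k) ->
    (forall k, measurable (D k)) ->
    (\int[P]_t (\sum_k f k * \1_(D k) t)%:E = (\sum_k f k * Pr (D k))%:E)%E.
  move=> f0 mD.
  under eq_integral do rewrite -sumEFin.
  rewrite ge0_integral_sum //; last 2 first.
  - move=> k; apply/measurable_EFinP; exact: measurable_funM.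
  - by move=> k t _; rewrite lee_fin mulr_ge0.
  rewrite -sumEFin; apply: eq_bigr => k _.
  under eq_integral do rewrite EFinM.
  rewrite ge0_integralZl_EFin //; last first.
  - by apply/measurable_EFinP.
  by rewrite integral_indic // setIT EFinM -PrE.
rewrite -lee_fin -!key //; apply: ge0_le_integral => //.
- by move=> t _; rewrite lee_fin; apply: sumr_ge0 => i _; rewrite mulr_ge0.
- apply/measurable_EFinP; apply: measurable_sum => i.
  exact: measurable_funM.
- apply/measurable_EFinP; apply: measurable_sum => i.
  exact: measurable_funM.
- by move=> t _; rewrite lee_fin.
Qed.

Lemma union_bound (I : finType) (A : set T) (B : I -> set T) :
  measurable A -> (forall i, measurable (B i)) ->
  (forall t, A t -> exists i, B i t) -> Pr A <= \sum_i Pr (B i).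
Proof.
move=> mA mB AB.
have := @le_sum_Pr unit I (fun=> 1) (fun=> A) (fun=> 1) B.
rewrite big_const card_unit /= mul1r addr0.
under eq_bigr do rewrite mul1r; apply=> // t.
rewrite big_const card_unit /= mul1r addr0 [X in X <= _]indicE.
case: (boolP (t \in A)) => [|_]; last by apply: sumr_ge0 => i _; rewrite mul1r.
rewrite inE => /AB [i Bi]; rewrite (bigD1 i) //= mul1r indicE mem_set // lerDl.
by apply: sumr_ge0 => j _; rewrite mul1r.
Qed.

(** Chebyshev's inequality for the number Z of events that occur: if mu is its
    mean, mu ^ 2 [Z = 0] + 2 mu Z <= Z ^ 2 + mu ^ 2 pointwise. *)
Lemma second_moment (I : finType) (A : I -> set T) (p delta : R) :
  (forall i, measurable (A i)) -> (forall i, Pr (A i) = p) ->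
  0 < p -> (0 < #|I|)%N ->
  \sum_i \sum_j Pr (A i `&` A j) <= (1 + delta) * (#|I|%:R * p) ^+ 2 ->
  Pr [set t | forall i, ~ A i t] <= delta.
Proof.
move=> mA PA p0 I0; set mu := #|I|%:R * p => h.
have mu0 : 0 < mu by rewrite mulr_gt0 // ltr0n.
set Z0 := [set t | forall i, ~ A i t].
have mZ0 : measurable Z0.
  rewrite (_ : Z0 = \bigcap_(i in [set: I]) ~` A i).
    by apply: fin_bigcap_measurable => // i _; exact: measurableC.
  by apply/seteqP; split => [t h' i _|t h' i]; apply: h'.
(* The index None carries the terms mu ^ 2 [Z = 0] and mu ^ 2. *)
have := @le_sum_Pr (option I) (option (I * I))
  (fun o => if o is Some _ then 2 * mu else mu ^+ 2)
  (fun o => if o is Some i then A i else Z0)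
  (fun o => if o is Some _ then 1 else mu ^+ 2)
  (fun o => if o is Some ij then A ij.1 `&` A ij.2 else setT).
rewrite !sum_option /= probability_setT mulr1 -mulr_sumr.
rewrite (eq_bigr (fun=> p) (fun i _ => PA i)).
rewrite (eq_bigr _ (fun ij _ => mul1r (Pr (A ij.1 `&` A ij.2)))).
rewrite sumr_const -[p *+ _]mulr_natl -/mu.
rewrite -(pair_bigA _ (fun i j => Pr (A i `&` A j))) /=.
move=> le; have {}le : mu ^+ 2 * Pr Z0 + 2 * mu * mu <=
    mu ^+ 2 + \sum_i \sum_j Pr (A i `&` A j).
  apply: le.
  - by case=> [i|]; rewrite ?sqr_ge0 // mulr_ge0 // ltW.
  - by case=> [i|]; rewrite ?sqr_ge0.
  - by case.
  - by case=> [ij|] //; exact: measurableI.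
  move=> t; rewrite !sum_option /= indicT mulr1 -mulr_sumr.
  set Z := \sum_i \1_(A i) t.
  have -> : \sum_(ij : I * I) 1 * \1_(A ij.1 `&` A ij.2) t = Z ^+ 2.
    rewrite expr2 /Z big_distrl /=.
    under [RHS]eq_bigr do rewrite big_distrr /=.
    rewrite pair_bigA /=; apply: eq_bigr => ij _.
    by rewrite mul1r indicI.
  have [/set_mem tZ|tZ] := boolP (t \in Z0).
    have -> : Z = 0.
      by apply: big1 => i _; rewrite indicE memNset //; exact: tZ.
    rewrite mulr0 expr0n addr0 /= addr0 indicE mem_set // mulr1; exact: lexx.
  rewrite indicE (negbTE tZ) mulr0 add0r; have := sqr_ge0 (mu - Z).
  by rewrite sqrrB; lra.
have m2 : 0 < mu ^+ 2 by rewrite exprn_gt0.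
rewrite -(ler_pM2l m2); move: le h; rewrite expr2; lra.
Qed.

End Probability.

Section Independence.
Context (R : realType) (d : nat) (b : 'I_d -> nat)
  (disp : measure_display) (T : measurableType disp) (P : probability T R)
  (pi : forall j, seq 'I_(b j) -> T -> {perm 'I_(b j)})
  (piP : owen_permutations P pi).

Local Notation "'Pr' A" := (fine (P A)) (at level 10, A at level 8).

Lemma measurable_perm_in j a (A : {set {perm 'I_(b j)}}) :
  measurable [set t | @pi j a t \in A].
Proof.
have [m _ _] := piP.
rewrite (_ : [set t | _] = \bigcup_(s in [set` A]) [set t | @pi j a t = s]).
  exact: fin_bigcup_measurable.
by apply/seteqP; split=> [t tA|t [s sA /= ->] //]; exists (@pi j a t).
Qed.

Lemma Pr_perm_in j a (A : {set {perm 'I_(b j)}}) :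
  P [set t | @pi j a t \in A] = (#|A|%:R / (b j)`!%:R)%:E.
Proof.
have [m u _] := piP.
rewrite (_ : [set t | _] = \bigcup_(s in [set` A]) [set t | @pi j a t = s]).
  rewrite measure_fin_bigcup //; last first.
    by move=> s s' _ _ [t [/= <- <-]].
  rewrite (_ : [set` A] = [set` enum A]); last first.
    by apply/seteqP; split=> s /=; rewrite mem_enum.
  rewrite -fsbig_seq ?enum_uniq // (eq_bigr _ (fun s _ => u j a s)) sumEFin.
  by rewrite big_enum /= sumr_const mulr_natl.
by apply/seteqP; split=> [t tA|t [s sA /= ->] //]; exists (@pi j a t).
Qed.

(** Prescriptions are grouped by coordinate, so that a prefix and the set for
    its permutation have matching types without casts. *)
Definition requirement
    (L : forall j, seq (seq 'I_(b j) * {set {perm 'I_(b j)}})) : set T :=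
  [set t | forall j q, q \in L j -> @pi j q.1 t \in q.2].

Lemma measurable_requirement L : measurable (requirement L).
Proof.
rewrite (_ : requirement L = \bigcap_(j in [set: 'I_d])
  \bigcap_(q in [set` L j]) [set t | @pi j q.1 t \in q.2]).
  apply: fin_bigcap_measurable => // j _.
  by apply: fin_bigcap_measurable => // q _; exact: measurable_perm_in.
by apply/seteqP; split=> t h; [move=> j _ q qL; exact: h|move=> j q; exact: h].
Qed.

(** Permutations at different prefixes or in different coordinates are
    independent, so that it suffices to avoid repetitions in each coordinate. *)
Lemma Pr_requirement L : (forall j, uniq (unzip1 (L j))) ->
  Pr (requirement L) =
  \prod_j \prod_(q <- L j) (#|q.2|%:R / (b j)`!%:R).
Proof.
move=> uL; have [_ _ ind] := piP.
pose A (k : {j : 'I_d & seq 'I_(b j)}) : {set {perm 'I_(b (tag k))}} :=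
  finset (fun s : {perm 'I_(b (tag k))} =>
    all (fun q : seq 'I_(b (tag k)) * {set {perm 'I_(b (tag k))}} => (q.1 ==
      tagged k) ==> (s \in q.2)) (L (tag k))).
pose key j (q : seq 'I_(b j) * {set {perm 'I_(b j)}}) :
  {j : 'I_d & seq 'I_(b j)} := Tagged (fun j => seq 'I_(b j)) q.1.
have Ainj j q q' : q \in L j -> q' \in L j -> q.1 = q'.1 -> q = q'.
  move=> qL qL' e; have := uL j => /(@uniqP _ q.1) h.
  have i1 : (index q (L j) < size (unzip1 (L j)))%N by rewrite size_map
    index_mem.
  have i2 : (index q' (L j) < size (unzip1 (L j)))%N by rewrite size_map
    index_mem.
  have := h _ _ i1 i2; rewrite !(nth_map q) ?index_mem // !nth_index //.
  by move=> /(_ e) /(congr1 (nth q (L j))); rewrite !nth_index.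
have AE j q : q \in L j -> A (key j q) = q.2.
  move=> qL; apply/setP => s; rewrite inE /=; apply/allP/idP => [/(_ q qL)|sq r
    rL].
    by rewrite eqxx.
  by apply/implyP => /eqP e; rewrite (Ainj j r q).
pose s := [seq key j q | j <- index_enum 'I_d, q <- L j].
have us : uniq s.
  apply: allpairs_uniq_dep; first exact: index_enum_uniq.
    by move=> j _; exact: map_uniq (uL j).
  move=> u u' /allpairsPdep[i [r [_ rL ->]]] /allpairsPdep[i' [r' [_ rL' ->]]].
  rewrite /key /= => e; have e' : i = i' := congr1 tag e.
  subst i'; have {}e : r.1 = r'.1 by exact: eq_from_Tagged e.
  by rewrite (Ainj i r r').
have := ind s A us.
rewrite (_ : [set t | _] = requirement L); last first.
  apply/seteqP; split => t h.
    move=> j q qL; rewrite -(AE j q qL); apply: (h (key j q)).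
    by apply/allpairsPdep; exists j, q; split => //; rewrite mem_index_enum.
  move=> k /allpairsPdep[j [q [_ qL ->]]]; rewrite (AE j q qL); exact: (h j q
    qL).
move=> ->; rewrite /s big_allpairs_dep /=.
rewrite (eq_bigr (fun j => (\prod_(q <- L j) (#|q.2|%:R / (b j)`!%:R))%:E));
  last first.
  move=> j _; rewrite -prodEFin [LHS]big_seq [RHS]big_seq.
  apply: eq_bigr => q qL.
  by rewrite /= Pr_perm_in AE.
by rewrite prodEFin.
Qed.

End Independence.

(** * Distance of two numbers in terms of their digits *)

Section CloseDigits.
Context (R : realType) (b : nat) (hb : (1 < b)%N) (a a' : nat -> nat)
  (ab : forall r, (a r < b)%N) (ab' : forall r, (a' r < b)%N).

Let bi0 i : 0 < (b%:R : R) ^+ i.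
Proof. by rewrite exprn_gt0 // ltr0n ltnW. Qed.

Lemma close_digits k l : digits_int b a k <> digits_int b a' k ->
  `|digits_value R b a - digits_value R b a'| < (b%:R ^+ (k + l))^-1 ->
  (forall r, (k <= r < k + l)%N -> a r = b.-1 /\ a' r = 0%N) \/
  (forall r, (k <= r < k + l)%N -> a r = 0%N /\ a' r = b.-1).
Proof.
move=> ne; have := digits_value_window R hb ab (k + l).
have := digits_value_window R hb ab' (k + l).
rewrite !ler_pdivrMr // !ler_pdivlMr // -!(natr1 (digits_int _ _ _)).
set H := digits_int b a _; set H' := digits_int b a' _ => h' h.
rewrite -[X in _ < X]mul1r ltr_pdivlMr // -[X in _ * X](ger0_norm (ltW (bi0
  _))).
rewrite -normrM.
rewrite mulrBl ltr_norml => c.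
have HH : H <> H'.
  move=> /(digits_int_inj ab ab') e; apply: ne; apply: eq_digits_int => r rk.
  by apply: e; lia.
have l1 : (H < H'.+2)%N by rewrite -(ltr_nat R) -!natr1; lra.
have l2 : (H' < H.+2)%N by rewrite -(ltr_nat R) -!natr1; lra.
have [e|e] : H.+1 = H' \/ H'.+1 = H by lia.
  by left; have [_] := digits_int_carry ab ab' ne e.
right; have [_ f] := digits_int_carry ab' ab (nesym ne) e.
by move=> r /f[].
Qed.

(** Partial converse of [close_digits], with the carry as an assumption. *)
Lemma digits_close k l : (digits_int b a k).+1 = digits_int b a' k ->
  (forall r, (k <= r < k + l)%N -> a r = b.-1 /\ a' r = 0%N) ->
  `|digits_value R b a - digits_value R b a'| <= 2 / b%:R ^+ (k + l).
Proof.
move=> e f; have := digits_int_carry_intro (ltnW hb) e f.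
have := digits_value_window R hb ab (k + l).
have := digits_value_window R hb ab' (k + l).
move=> + + e'; rewrite -{}e' -!(natr1 (digits_int _ _ _)) -natr1.
rewrite !mulrDl !mul1r ler_norml.
have : 0 < ((b%:R : R) ^+ (k + l))^-1 by rewrite invr_gt0.
lra.
Qed.

End CloseDigits.

Section Requirements.
Context (b : nat) (hb : (0 < b)%N).

(** Prescribes the value v for the l scrambled digits of n from position i0 on
    ([digit_runP]); positions count from 0. *)
Definition digit_run n (v : 'I_b) i0 l : seq (seq 'I_b * {set {perm 'I_b}}) :=
  [seq (prefix_digits hb n i, perm_at (digit hb n i) v) | i <- iota i0 l].

Lemma digit_runP n v i0 l (sigma : seq 'I_b -> {perm 'I_b}) :
  (forall q, q \in digit_run n v i0 l -> sigma q.1 \in q.2) <->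
  (forall r, (i0 <= r < i0 + l)%N -> scrambled_digit hb sigma n r = v).
Proof.
split=> [h r rl|h _ /mapP[r rl ->]].
  have := h (prefix_digits hb n r, perm_at (digit hb n r) v).
  by rewrite /= inE => /(_ (map_f _ _)) /=; rewrite mem_iota => /(_ rl) /eqP.
by rewrite inE /=; apply/eqP/h; rewrite -mem_iota.
Qed.

Lemma prod_digit_run (R : realType) n v i0 l :
  \prod_(q <- digit_run n v i0 l) (#|q.2|%:R / b`!%:R) = (b%:R ^+ l)^-1 :> R.
Proof.
rewrite big_map /= -exprVn.
under eq_bigr => i _.
  have -> : #|perm_at (digit hb n i) v|%:R / b`!%:R = b%:R^-1 :> R.
    rewrite -(card_perm_at (digit hb n i) v) natrM invfM mulrA divff ?mul1r //.
    rewrite pnatr_eq0 -lt0n; have := card_perm_at (digit hb n i) v.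
    by case: #|_| => // /esym /eqP; rewrite mul0n eqn0Ngt fact_gt0.
  over.
by rewrite big_const_seq count_predT size_iota iter_mulr_1.
Qed.

Lemma digit_run_key n v i0 l (a : seq 'I_b) :
  a \in unzip1 (digit_run n v i0 l) ->
  exists2 i, (i0 <= i)%N & a = prefix_digits hb n i.
Proof.
by rewrite /unzip1 -map_comp => /mapP[i]; rewrite mem_iota => /andP[? _] ->;
  exists i.
Qed.

Lemma prefix_digits_inj n n' i i' :
  prefix_digits hb n i = prefix_digits hb n' i' ->
  i = i' /\ (n = n' %[mod b ^ i])%N.
Proof.
move=> e; have ii : i = i' by have := congr1 size e; rewrite !size_mkseq.
by split => //; apply/(eq_prefix_digits hb); rewrite e ii.
Qed.

Lemma uniq_digit_run n v i0 l : uniq (unzip1 (digit_run n v i0 l)).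
Proof.
rewrite /unzip1 -map_comp map_inj_uniq ?iota_uniq // => i i' /=.
by move=> /prefix_digits_inj[].
Qed.

Lemma eqmod_expn_le n n' i k : (k <= i)%N -> (n = n' %[mod b ^ i])%N ->
  (n = n' %[mod b ^ k])%N.
Proof.
move=> ki e; rewrite -(subnKC ki) expnD in e.
by rewrite -(modn_dvdm n (dvdn_mulr (b ^ (i - k)) (dvdnn (b ^ k)))) e modn_dvdm
  // dvdn_mulr.
Qed.

End Requirements.

(** * Measurability of the scrambled points *)

Section Pairs.
Context (R : realType) (d : nat) (b : 'I_d -> nat)
  (hb : forall j, (1 < b j)%N)
  (disp : measure_display) (T : measurableType disp) (P : probability T R)
  (pi : forall j, seq 'I_(b j) -> T -> {perm 'I_(b j)})
  (piP : owen_permutations P pi).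

Local Notation "'Pr' A" := (fine (P A)) (at level 10, A at level 8).
Local Notation x := (scrambled_halton R hb pi).
Local Notation b0 j := (ltnW (hb j)).
Local Notation sdigit t j := (scrambled_digit (b0 j) (fun a => @pi j a t)).

Lemma measurable_perm_fun j a (f : {perm 'I_(b j)} -> R) :
  measurable_fun setT (fun t => f (@pi j a t)).
Proof.
move=> _ Y mY; rewrite setTI.
have := measurable_perm_in piP a (finset (fun s : {perm 'I_(b j)} => `[< Y (f s)
  >])).
congr (measurable _); apply/seteqP; split => t /=; rewrite inE; first by
  move/asboolP.
by move=> ?; apply/asboolP.
Qed.

Lemma measurable_scrambled_halton n j :
  measurable_fun setT (fun t => x t n 0 j).
Proof.
under eq_fun do rewrite scrambled_haltonE.
apply: (@measurable_fun_cvg _ _ _ _ (fun m t => series (fun r =>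
    (sdigit t j n r : nat)%:R / (b j)%:R ^+ r.+1 : R) m)) => [m|t _].
  rewrite /series /=; apply: measurable_sum => r.
  by apply: (@measurable_perm_fun j (prefix_digits (b0 j) n r) (fun s => (s
    (digit (b0 j) n r) : nat)%:R / (b j)%:R ^+ r.+1)).
exact: (@cvg_digits_value _ _ (hb j)).
Qed.

Lemma measurable_coord_dist n n' j :
  measurable_fun setT (fun t => `|x t n 0 j - x t n' 0 j|).
Proof.
apply: measurableT_comp => //.
by apply: measurable_funB; exact: measurable_scrambled_halton.
Qed.

(** * Probability that two points are close *)

Definition zero_digit j : 'I_(b j) := Ordinal (b0 j).

Lemma ltn_last_digit j : ((b j).-1 < b j)%N.
Proof. by rewrite ltn_predL (ltnW (hb j)). Qed.

Definition last_digit j : 'I_(b j) := Ordinal (ltn_last_digit j).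

(** If r <= b_j ^ - (k_j + 1 + l_j), then two numbers that differ at the digit
    k_j at the latest are at distance less than r only if, after that digit, one
    of them has l_j digits 0 and the other one l_j digits b_j - 1. *)
Lemma Pr_pair_close n n' (k l : 'I_d -> nat) (r : R) :
  (forall j, n <> n' %[mod b j ^ (k j).+1])%N ->
  (forall j, l j = 0%N \/ r <= ((b j)%:R ^+ ((k j).+1 + l j))^-1) ->
  Pr [set t | forall j, `|x t n 0 j - x t n' 0 j| < r] <=
  2 ^+ d * \prod_j ((b j)%:R ^+ (l j).*2)^-1.
Proof.
move=> nn hr.
(* The signs e tell, for each coordinate, which of the two points is below. *)
pose L (e : {ffun 'I_d -> bool}) j :=
  digit_run (b0 j) n (if e j then last_digit j else zero_digit j) (k j).+1 (l j)
  ++ digit_run (b0 j) n' (if e j then zero_digit j else last_digit j) (k j).+1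
    (l j).
have uL e j : uniq (unzip1 (L e j)).
  rewrite /unzip1 map_cat cat_uniq !uniq_digit_run andbT /=.
  apply/hasPn => a /digit_run_key[i ki ->]; apply/negP => /digit_run_key[i'
    ki'].
  move=> /prefix_digits_inj[ii /esym]; move: ki ki'; rewrite {}ii => _ ki h.
  exact: (nn j (eqmod_expn_le ki h)).
have mx : measurable [set t | forall j, `|x t n 0 j - x t n' 0 j| < r].
  rewrite (_ : [set t | _] = \bigcap_(j in [set: 'I_d])
     [set t | `|x t n 0 j - x t n' 0 j| < r]); last first.
    by apply/seteqP; split=> t h j; [move=> _|]; apply: h.
  apply: fin_bigcap_measurable => // j _.
  rewrite -[X in measurable X]setTI.
  exact: (measurable_fun_ltr (measurable_coord_dist n n' j) (measurable_cst r)).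
apply: (@le_trans _ _ (\sum_e Pr (requirement pi (L e)))).
  apply: union_bound => // [e|t]; first exact: (measurable_requirement piP).
  move=> /= h.
  have sgn j : exists s : bool, forall q, q \in
      digit_run (b0 j) n (if s then last_digit j else zero_digit j) (k j).+1 (l
        j)
      ++ digit_run (b0 j) n' (if s then zero_digit j else last_digit j)
        (k j).+1 (l j) -> @pi j q.1 t \in q.2.
    have [l0|rb] := hr j; first by exists true => q; rewrite l0.
    have ne : digits_int (b j) (sdigit t j n) (k j).+1 <>
              digits_int (b j) (sdigit t j n') (k j).+1.
      by move/(eq_cell (b0 j) (fun a => @pi j a t)); exact: nn.
    have := h j; rewrite !scrambled_haltonE => /lt_le_trans /(_ rb).
    move=> /(close_digits (hb j) (fun r => ltn_ord _) (fun r => ltn_ord _) ne).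
    have E v v' : (forall r, ((k j).+1 <= r < (k j).+1 + l j)%N ->
        (sdigit t j n r : nat) = (v : 'I_(b j)) /\
        (sdigit t j n' r : nat) = (v' : 'I_(b j))) ->
      forall q, q \in digit_run (b0 j) n v (k j).+1 (l j) ++
        digit_run (b0 j) n' v' (k j).+1 (l j) -> @pi j q.1 t \in q.2.
      move=> vv q; rewrite mem_cat => /orP[].
        apply: (iffRL (digit_runP (b0 j) n v _ _ (fun a => @pi j a t))).
        by move=> s /vv[e _]; exact: val_inj.
      apply: (iffRL (digit_runP (b0 j) n' v' _ _ (fun a => @pi j a t))).
      by move=> s /vv[_ e]; exact: val_inj.
    by case=> vv; [exists true|exists false]; apply: E.
  have [e he] := choice sgn.
  by exists [ffun j => e j] => j q; rewrite /L ffunE; exact: he.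
have PL e : Pr (requirement pi (L e)) = \prod_j ((b j)%:R ^+ (l j).*2)^-1.
  rewrite (Pr_requirement piP) //; apply: eq_bigr => j _.
  by rewrite big_cat /= !prod_digit_run -invfM -exprD addnn.
rewrite (eq_bigr _ (fun e _ => PL e)) sumr_const card_ffun card_bool card_ord.
by rewrite -[X in X <= _]mulr_natl natrX.
Qed.

End Pairs.

(** * Counting pairs of indices by their common prefixes *)

Section Counting.
Local Open Scope nat_scope.

Lemma exists_valuation b m : 1 < b -> 0 < m ->
  exists k, b ^ k %| m /\ ~~ (b ^ k.+1 %| m).
Proof.
move=> b1 m0.
have ex : exists k, b ^ k %| m by exists 0; rewrite expn0 dvd1n.
have ub k : b ^ k %| m -> k <= m.
  by move=> /(dvdn_leq m0) h; rewrite ltnW // (leq_trans (ltn_expl k b1)).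
have [k dk mk] := ex_maxnP ex ub; exists k; split=> //.
by apply/negP => /mk; rewrite ltnn.
Qed.

Lemma card_congruent N n D : 0 < D -> D <= N ->
  #|finset (fun n' : 'I_N => (n < n') && (D %| n' - n))| * D <= 2 * N.
Proof.
move=> D0 DN.
pose f (n' : 'I_N) : 'I_(N %/ D).+1 := inord (n' %/ D).
have fE (n' : 'I_N) : (f n' : nat) = n' %/ D.
  by rewrite inordK // ltnS leq_div2r // ltnW.
have inj : {in finset (fun n' : 'I_N => (n < n') && (D %| n' - n)) &, injective
  f}.
  move=> n1 n2; rewrite !inE => /andP[l1 d1] /andP[l2 d2] e.
  have e' : n1 %/ D = n2 %/ D by rewrite -!fE e.
  apply: val_inj; rewrite /= (divn_eq n1 D) (divn_eq n2 D) e'; congr (_ + _).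
  have h (m : nat) : n < m -> D %| m - n -> m %% D = n %% D.
    by move=> lt; rewrite -eqn_mod_dvd ?(ltnW lt) // => /eqP.
  by rewrite !h.
rewrite -(card_in_imset inj).
apply: (@leq_trans ((N %/ D).+1 * D)).
  rewrite leq_mul2r; apply/orP; right.
  by apply: leq_trans (max_card _) _; rewrite card_ord.
by rewrite mulSn; have := leq_divM N D; lia.
Qed.

Lemma geometric_sum_lt b c N L : 1 < b ->
  \sum_(i < L | c * b ^ i < N) c * b ^ i <= 2 * N.
Proof.
move=> b1; suff : \sum_(i < L | c * b ^ i < N) c * b ^ i <= c * b ^ L /\
    \sum_(i < L | c * b ^ i < N) c * b ^ i <= 2 * N by case.
elim: L => [|L [IH1 IH2]]; first by rewrite big_ord0.
rewrite big_mkcond big_ord_recr -big_mkcond /=.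
rewrite expnS mulnCA; move: (\sum_(i < L | _) _) IH1 IH2 => S.
have := leq_mul b1 (leqnn (c * b ^ L)); case: ifP; lia.
Qed.

(** The sum over all exponents but one is bounded by the number of terms; the
    sum over the last one is geometric, so that it costs no logarithm. *)
Lemma sum_products_lt d (b : 'I_d -> nat) N L : 0 < d -> (forall j, 1 < b j) ->
  \sum_(k : {ffun 'I_d -> 'I_L} | \prod_j b j ^ k j < N) \prod_j b j ^ k j
    <= 2 * N * L ^ d.-1.
Proof.
case: d b => // d b _ b1 /=.
pose tl (k : {ffun 'I_d.+1 -> 'I_L}) : {ffun 'I_d -> 'I_L} :=
  [ffun i => k (lift ord0 i)].
rewrite (partition_big tl predT) //=.
apply: (@leq_trans (\sum_(u : {ffun 'I_d -> 'I_L}) 2 * N)); last first.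
  by rewrite sum_nat_const card_ffun !card_ord mulnC.
apply: leq_sum => u _.
pose cons (i : 'I_L) : {ffun 'I_d.+1 -> 'I_L} :=
  [ffun j => if unlift ord0 j is Some j' then u j' else i].
rewrite (reindex_onto cons (fun k => k ord0)) /=; last first.
  move=> k /andP[_ /eqP e]; apply/ffunP => j; rewrite ffunE.
  by case: unliftP => [j' ->|->] //; rewrite -e ffunE.
pose c := \prod_(j < d) b (lift ord0 j) ^ u j.
have E i : \prod_j b j ^ cons i j = c * b ord0 ^ i.
  rewrite big_ord_recl ffunE unlift_none mulnC; congr (_ * _).
  by apply: eq_bigr => j _; rewrite ffunE liftK.
apply: leq_trans (geometric_sum_lt c N L (b1 ord0)).
rewrite [X in _ <= X]big_mkcond [X in X <= _]big_mkcond /=.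
by apply: leq_sum => i _; rewrite E; case: ifP => [/andP[/andP[-> _] _]|].
Qed.

End Counting.

(** The largest l with r <= b ^ - (k + 1 + l), or 0 if there is none, in which
    case r b ^ (k + 2) exceeds 1. *)
Lemma exists_run_length (R : realType) b k (r : R) : (1 < b)%N -> 0 < r ->
  exists l, (l = 0%N \/ r <= (b%:R ^+ (k.+1 + l))^-1) /\
            (b%:R ^+ l)^-1 <= r * b%:R ^+ k.+2.
Proof.
move=> b1 r0.
have bi0 i : 0 < (b%:R : R) ^+ i by rewrite exprn_gt0 // ltr0n ltnW.
pose p l := ((b%:R : R) ^+ (k.+1 + l))^-1 < r.
have ex : exists l, p l.
  exists (Num.bound r^-1); rewrite /p invf_plt ?posrE //.
  apply: lt_trans (archi_boundP _) _; first by rewrite invr_ge0 ltW.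
  rewrite -natrX ltr_nat; apply: leq_trans (ltn_expl _ b1) _.
  by rewrite leq_exp2l // leq_addl.
have [[|l] pl ml] := ex_minnP ex.
  exists 0%N; split; first by left.
  move: pl; rewrite /p addn0 invf_plt ?posrE // expr0 invr1 => h.
  rewrite mulrC -ler_pdivrMr // mul1r (le_trans (ltW h)) //.
  by rewrite ler_eXn2l // ltr1n.
exists l; split; first by right; rewrite leNgt; apply/negP => /ml; rewrite ltnn.
move: pl; rewrite /p addnS -addSn exprD invfM -ltr_pdivlMl ?invr_gt0 // invrK.
by rewrite mulrC => /ltW.
Qed.

(** * Separation as a minimum over pairs *)

Section Separation.
Context (R : realType) (d : nat).

Lemma separation_ltP (x : nat -> 'rV[R]_d) N r : (1 < N)%N ->
  separation x N < r <->
  exists n n', [/\ (n < n')%N, (n' < N)%N & `|x n - x n'| < r].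
Proof.
move=> N1; split=> [h|[n [n' [nn nN h]]]].
  apply: contrapT => no; move: h; apply/negP; rewrite -leNgt.
  apply: lb_le_inf; first by exists `|x 0 - x 1|, 0%N, 1%N.
  move=> _ [n [n' [nn nN ->]]]; rewrite leNgt; apply/negP => h.
  by apply: no; exists n, n'.
apply: le_lt_trans h; apply: ge_inf; last by exists n, n'.
by exists 0 => _ [m [m' [_ _ ->]]].
Qed.

End Separation.

Section FirstMoment.
Context (R : realType) (d : nat) (b : 'I_d -> nat)
  (hb : forall j, (1 < b j)%N)
  (hcop : forall i j, i != j -> coprime (b i) (b j))
  (disp : measure_display) (T : measurableType disp) (P : probability T R)
  (pi : forall j, seq 'I_(b j) -> T -> {perm 'I_(b j)})
  (piP : owen_permutations P pi).

Local Notation "'Pr' A" := (fine (P A)) (at level 10, A at level 8).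
Local Notation x := (scrambled_halton R hb pi).

Lemma measurable_close n n' (r : R) :
  measurable [set t | `|x t n - x t n'| < r].
Proof.
have [r0|r0] := ltP 0 r; last first.
  rewrite (_ : [set t | _] = set0) //; apply/seteqP; split => t //= h.
  by have := le_lt_trans (normr_ge0 _) h; rewrite ltNge r0.
rewrite (_ : [set t | _] = \bigcap_(j in [set: 'I_d])
   [set t | `|x t n 0 j - x t n' 0 j| < r]).
  apply: fin_bigcap_measurable => // j _.
  rewrite -[X in measurable X]setTI.
  exact: (measurable_fun_ltr (measurable_coord_dist hb piP n n' j)
    (measurable_cst r)).
apply/seteqP; split=> t; rewrite /= norm_rV_lt //.
  by move=> /forallP h j _; have := h j; rewrite mxE [X in _ + X]mxE.
by move=> h; apply/forallP => j; rewrite mxE [X in _ + X]mxE; exact: h.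
Qed.

Lemma measurable_separation_lt N (r : R) : (1 < N)%N ->
  measurable [set t | separation (x t) N < r].
Proof.
move=> N1; rewrite (_ : [set t | _] = \bigcup_(p in [set p : 'I_N * 'I_N |
    (p.1 < p.2)%N]) [set t | `|x t p.1 - x t p.2| < r]).
  by apply: fin_bigcup_measurable => // p _; exact: measurable_close.
apply/seteqP; split => [t /(separation_ltP _ _ N1)[n [n' [nn nN h]]]|t [p /= pp
  h]].
  by exists (Ordinal (ltn_trans nn nN), Ordinal nN).
by apply/(separation_ltP _ _ N1); exists p.1, p.2.
Qed.

Let D (k : 'I_d -> nat) := (\prod_j b j ^ k j)%N.

Let K : R := 2 ^+ d * \prod_j (b j)%:R ^+ 4.

(** The factor prod_j b_j ^ (2 k_j) makes the pairs with long common prefixes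
    dominate the union bound. *)
Lemma Pr_close n n' (k : 'I_d -> nat) (r : R) : 0 < r ->
  (forall j, n <> n' %[mod b j ^ (k j).+1])%N ->
  Pr [set t | `|x t n - x t n'| < r] <= K * r ^+ d.*2 * (D k)%:R ^+ 2.
Proof.
move=> r0 nn.
have [l hl] := choice (fun j => exists_run_length (k j) (hb j) r0).
apply: le_trans (_ : 2 ^+ d * \prod_j ((b j)%:R ^+ (l j).*2)^-1 <= _).
  apply: le_trans (Pr_pair_close hb piP nn (fun j => (hl j).1)).
  rewrite (_ : [set t | forall j, _] = [set t | `|x t n - x t n'| < r]) //.
  apply/seteqP; split=> t; rewrite /= norm_rV_lt //.
    by move=> h; apply/forallP => j; rewrite mxE [X in _ + X]mxE; exact: h.
  by move=> /forallP h j; have := h j; rewrite mxE [X in _ + X]mxE.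
rewrite /K -!mulrA ler_pM2l ?exprn_gt0 //.
have -> : (r ^+ d.*2 * (D k)%:R ^+ 2) = \prod_j (r ^+ 2 * ((b j)%:R ^+ k j) ^+
  2).
  rewrite big_split /= prodr_const card_ord -mul2n exprM; congr (_ * _).
  by rewrite /D natr_prod prodrXl; congr (_ ^+ 2); apply: eq_bigr => j _;
    rewrite natrX.
rewrite -big_split /=; apply: ler_prod => j _.
rewrite invr_ge0 exprn_ge0 //=.
rewrite -muln2 exprM -exprVn.
have -> : (b j)%:R ^+ 4 * (r ^+ 2 * ((b j)%:R ^+ k j) ^+ 2) =
    (r * (b j)%:R ^+ (k j).+2) ^+ 2 :> R by rewrite !exprS expr0; ring.
have e0 i : 0 <= (b j)%:R ^+ i :> R by rewrite exprn_ge0.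
rewrite ler_pXn2r ?nnegrE ?invr_ge0 ?e0 //; first by case: (hl j).
exact: mulr_ge0 (ltW r0) (e0 _).
Qed.

(** Union bound over the pairs, grouped by their common prefixes. *)
Lemma Pr_separation_lt N (r : R) : (0 < d)%N -> (1 < N)%N -> 0 < r ->
  Pr [set t | separation (x t) N < r] <=
  4 * K * (r ^+ d.*2 * N%:R ^+ 3 * ((trunc_log 2 N).+1)%:R ^+ d.-1).
Proof.
move=> hd N1 r0; set L := (trunc_log 2 N).+1.
pose E (k : {ffun 'I_d -> 'I_L}) := D (fun j => k j).
pose W (k : {ffun 'I_d -> 'I_L}) : R := K * r ^+ d.*2 * (E k)%:R ^+ 2.
have K0 : 0 <= K by rewrite mulr_ge0 ?exprn_ge0 // prodr_ge0 // => j _; rewrite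
  exprn_ge0.
have Kr0 : 0 <= K * r ^+ d.*2 by rewrite mulr_ge0 // exprn_ge0 // ltW.
have W0 k : 0 <= W k by rewrite mulr_ge0 // exprn_ge0.
pose B (p : 'I_N * 'I_N) := if (p.1 < p.2)%N then
  [set t | `|x t p.1 - x t p.2| < r] else set0.
have mB p : measurable (B p) by rewrite /B; case: ifP => _ //; exact:
  measurable_close.
apply: (@le_trans _ _ (\sum_p Pr (B p))).
  apply: union_bound => // [|t /(separation_ltP _ _ N1)[n [n' [nn nN h]]]].
    exact: measurable_separation_lt.
  by exists (Ordinal (ltn_trans nn nN), Ordinal nN); rewrite /B /= nn.
(* Only the term of the actual exponents is used; the others are added so that
   the sum over p can be exchanged with the sum over k. *)
have PB p : Pr (B p) <= \sum_(k : {ffun 'I_d -> 'I_L} | (E k < N)%N)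
    ((p.1 < p.2) && (E k %| p.2 - p.1))%N%:R * W k.
  rewrite /B; case: ifP => [pp|_]; last first.
    by rewrite measure0; apply: sumr_ge0 => k _; rewrite mulr_ge0.
  have m0 : (0 < p.2 - p.1)%N by rewrite subn_gt0.
  have [v hv] := choice (fun j => exists_valuation (hb j) m0).
  have mN : (p.2 - p.1 < N)%N by apply: leq_ltn_trans (leq_subr _ _) (ltn_ord
    _).
  have vL j : (v j < L)%N.
    rewrite /L ltnS; apply: trunc_log_max => //.
    apply: leq_trans (leq_trans (dvdn_leq m0 (hv j).1) (ltnW mN)).
    by case: (v j) => // e; rewrite leq_exp2r // hb.
  pose k : {ffun 'I_d -> 'I_L} := [ffun j => Ordinal (vL j)].
  have kE j : (k j : nat) = v j by rewrite ffunE.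
  have Dk : (E k %| p.2 - p.1)%N.
    apply: dvdn_prod_coprime; first exact: coprime_pow.
    by move=> j; rewrite kE (hv j).1.
  have DN : (E k < N)%N by apply: leq_ltn_trans mN; apply: dvdn_leq.
  rewrite (bigD1 k) //= Dk mul1r; apply: ler_wpDr.
    by apply: sumr_ge0 => k' _; rewrite mulr_ge0.
  apply: Pr_close => // j e; have /negP := (hv j).2; apply.
  by rewrite kE in e; rewrite -eqn_mod_dvd ?(ltnW pp) //; apply/eqP.
apply: le_trans (ler_sum _ (fun p _ => PB p)) _.
rewrite exchange_big /=.
apply: (@le_trans _ _ (\sum_(k : {ffun 'I_d -> 'I_L} | (E k < N)%N)
    (2 * N%:R ^+ 2) * (K * r ^+ d.*2 * (E k)%:R))).
  apply: ler_sum => k DN.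
  have D0 : (0 < E k)%N by rewrite prodn_gt0 // => j; rewrite expn_gt0 ltnW.
  rewrite -mulr_suml -(pair_bigA _ (fun n n' : 'I_N =>
    ((n < n') && (E k %| n' - n))%N%:R)) /=.
  set S := \sum_i _; have -> : S * W k = S * (E k)%:R * (K * r ^+ d.*2 * (E
    k)%:R).
    by rewrite /W expr2; ring.
  rewrite ler_wpM2r ?(mulr_ge0 Kr0) //.
  rewrite mulr_suml.
  apply: (@le_trans _ _ (\sum_(n < N) 2 * N%:R)); last first.
    by rewrite sumr_const card_ord -[_ *+ N]mulr_natl expr2; lra.
  apply: ler_sum => n _; rewrite -natr_sum -natrM -natrM ler_nat.
  rewrite -[X in (X * _)%N](_ : #|finset (fun n' : 'I_N => (n < n')%N && (E k %|
    n' - n)%N)| = _).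
    by apply: card_congruent => //; exact: ltnW.
  by rewrite -sum1_card big_mkcond; apply: eq_bigr => n' _; rewrite inE; case:
    ifP.
rewrite -mulr_sumr -mulr_sumr -natr_sum.
have := sum_products_lt N L hd hb; rewrite -(ler_nat R) => h.
apply: (@le_trans _ _ ((2 * N%:R ^+ 2) * ((K * r ^+ d.*2) * (2 * N * L ^
  d.-1)%:R))).
  by rewrite ler_wpM2l ?mulr_ge0 ?exprn_ge0 // ler_wpM2l.
by rewrite !natrM natrX le_eqVlt; apply/orP; left; apply/eqP; ring.
Qed.

End FirstMoment.

(** * Second moment of the number of close pairs *)

(** The residues of n determine n, so that the left-hand side is a partial sum
    of the expanded product on the right. *)
Lemma sum_residues_le (R : realType) (d : nat) (F : 'I_d -> nat)
    (g : 'I_d -> nat -> R) :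
  (forall i j, i != j -> coprime (F i) (F j)) -> (forall j, 0 < F j)%N ->
  (forall j a, 0 <= g j a) ->
  \sum_(n < \prod_j F j) \prod_j g j (n %% F j)%N <=
  \prod_j \sum_(a < F j) g j a.
Proof.
move=> cF F0 g0; set m := (\prod_j F j)%N.
pose M := (\sum_j F j)%N.
have FM j : (F j <= M.+1)%N by rewrite /M (bigD1 j) //= -addnS leq_addr.
pose h (n : 'I_m) : {ffun 'I_d -> 'I_M.+1} := [ffun j => inord (n %% F j)].
have hE (n : 'I_m) j : (h n j : nat) = (n %% F j)%N.
  by rewrite ffunE inordK // (leq_trans _ (FM j)) // ltn_pmod.
have inj : injective h.
  move=> n n' e; apply: val_inj.
  by apply: (eqmod_prod_coprime cF (ltn_ord n) (ltn_ord n')) => j; rewrite -!hE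
    e.
rewrite [X in _ <= X](eq_bigr (fun j => \sum_(a < M.+1 | (a < F j)%N) g j a)).
  rewrite bigA_distr_big_dep /=.
  apply: (@le_trans _ _ (\sum_(f in codom h) \prod_j g j (f j))).
    rewrite (eq_bigl (mem (imset h (mem predT)))); last first.
      move=> f; apply/codomP/imsetP => [[n ->]|[n _ ->]]; last by exists n.
      by exists n.
    rewrite big_imset /=; last by move=> ? ? _ _ /inj.
    by apply: ler_sum => n _; apply: ler_prod => j _; rewrite g0 hE /=.
  rewrite big_mkcond [X in _ <= X]big_mkcond; apply: ler_sum => f _.
  case: ifP => [/codomP[n ->]|_]; last by case: ifP => // _; exact: prodr_ge0.
  case: ifPn => // /negP[]; apply/familyP => j.
  by rewrite unfold_in /= hE ltn_pmod.
by move=> j _; rewrite (big_ord_widen _ _ (FM j)).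
Qed.

Section SecondMoment.
Context (R : realType) (d : nat) (b : 'I_d -> nat)
  (hb : forall j, (1 < b j)%N)
  (hcop : forall i j, i != j -> coprime (b i) (b j))
  (disp : measure_display) (T : measurableType disp) (P : probability T R)
  (pi : forall j, seq 'I_(b j) -> T -> {perm 'I_(b j)})
  (piP : owen_permutations P pi).

Local Notation "'Pr' A" := (fine (P A)) (at level 10, A at level 8).
Local Notation x := (scrambled_halton R hb pi).
Local Notation b0 j := (ltnW (hb j)).
Local Notation sdigit t j := (scrambled_digit (b0 j) (fun a => @pi j a t)).
Local Notation zero_digit := (zero_digit hb).
Local Notation last_digit := (last_digit hb).

Definition one_digit j : 'I_(b j) := Ordinal (hb j).

Variables k l : 'I_d -> nat.

Let m := (\prod_j b j ^ k j)%N.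

Let bk0 j : (0 < b j ^ k j)%N. Proof. by rewrite expn_gt0 ltnW. Qed.

Let m0 : (0 < m)%N. Proof. exact: prodn_gt0. Qed.

Lemma shift_eqmod n j : (n + m = n %[mod b j ^ k j])%N.
Proof.
apply/eqP; rewrite -[X in _ == X %[mod _]]addn0 eqn_modDl mod0n.
by rewrite -/(_ %| _)%N /m (bigD1 j) //= dvdn_mulr.
Qed.

Lemma shift_neqmod n j : (n + m <> n %[mod b j ^ (k j).+1])%N.
Proof.
move=> /eqP; rewrite -[X in _ == X %[mod _]]addn0 eqn_modDl mod0n.
rewrite -/(_ %| _)%N /m (bigD1 j) //= expnSr dvdn_pmul2l // => dv.
have c : coprime (b j) (\prod_(i < d | i != j) b i ^ k i).
  apply: (big_ind (fun z => coprime (b j) z)); first exact: coprimen1.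
    by move=> u v cu cv; rewrite coprimeMr cu.
  by move=> i ij; rewrite coprimeXr // hcop // eq_sym.
move: c; rewrite /coprime (gcdn_idPl dv) => /eqP e.
by have := hb j; rewrite e.
Qed.

Lemma shift_digit n j :
  digit (b0 j) n (k j) != digit (b0 j) (n + m) (k j).
Proof.
apply/eqP => /eq_digit e; apply: (@shift_neqmod n j); symmetry.
apply/eqmod_digits => r; rewrite ltnS leq_eqVlt => /orP[/eqP -> //|].
by have /eqmod_digits h := esym (@shift_eqmod n j); apply: h.
Qed.

(** The indices n and n + m share exactly k_j digits in base b_j. Their
    scrambled points are close if their next digits are 0 and 1, followed by
    l_j digits b_j - 1 and by l_j digits 0 respectively. *)
Definition close_pair n j : seq (seq 'I_(b j) * {set {perm 'I_(b j)}}) :=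
  (prefix_digits (b0 j) n (k j),
   perm_at2 (digit (b0 j) n (k j)) (zero_digit j)
            (digit (b0 j) (n + m) (k j)) (one_digit j))
  :: digit_run (b0 j) n (last_digit j) (k j).+1 (l j)
  ++ digit_run (b0 j) (n + m) (zero_digit j) (k j).+1 (l j).

Let A n : set T := requirement pi (close_pair n).

Lemma close_pair_key n j a : a \in unzip1 (close_pair n j) ->
  exists u i, [/\ (u = n %[mod b j ^ k j])%N, (k j <= i)%N
    & a = prefix_digits (b0 j) u i].
Proof.
rewrite /unzip1 /= inE map_cat mem_cat => /orP[/eqP ->|/orP[]].
- by exists n, (k j).
- by move=> /digit_run_key[i ki ->]; exists n, i; split => //; exact: ltnW.
- move=> /digit_run_key[i ki ->]; exists (n + m)%N, i.
  by split; [exact: shift_eqmod|exact: ltnW|].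
Qed.

Lemma uniq_close_pair n j : uniq (unzip1 (close_pair n j)).
Proof.
rewrite /unzip1 /= map_cat cat_uniq !uniq_digit_run andbT /= mem_cat.
apply/andP; split.
  by apply/negP => /orP[] /digit_run_key[i ki] /prefix_digits_inj[ii _];
    move: ki; rewrite -ii ltnn.
apply/hasPn => a /digit_run_key[i ki ->]; apply/negP => /digit_run_key[i' ki'].
move=> /prefix_digits_inj[ii h].
exact: (@shift_neqmod n j (eqmod_expn_le ki h)).
Qed.

(** Probability of the prescriptions close_pair n j. It does not depend on n,
    because all pairs of distinct digits are alike; those written here are
    arbitrary. *)
Definition close_prob j : R :=
  #|perm_at2 (zero_digit j) (zero_digit j) (one_digit j) (one_digit j)|%:R
    / (b j)`!%:R * ((b j)%:R ^+ (l j).*2)^-1.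

(** At least one permutation has the two prescribed values. *)
Lemma close_prob_ge j :
  ((b j)`!%:R)^-1 * ((b j)%:R ^+ (l j).*2)^-1 <= close_prob j.
Proof.
rewrite /close_prob ler_wpM2r ?invr_ge0 ?exprn_ge0 // ler_peMl ?invr_ge0 //.
rewrite ler1n card_gt0; apply/set0Pn.
by have [s] := @exists_perm_at2 _ (zero_digit j) (zero_digit j) (one_digit j)
  (one_digit j) isT isT; exists s.
Qed.

Lemma close_prob_gt0 j : 0 < close_prob j.
Proof.
apply: lt_le_trans (close_prob_ge j).
by rewrite mulr_gt0 // invr_gt0 ?exprn_gt0 // ltr0n ?fact_gt0 // ltnW.
Qed.

Lemma prod_close_pair n j :
  \prod_(q <- close_pair n j) (#|q.2|%:R / (b j)`!%:R) = close_prob j.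
Proof.
rewrite big_cons big_cat /= !prod_digit_run -invfM -exprD addnn.
by rewrite (@card_perm_at2 _ _ _ (zero_digit j) (one_digit j)) // shift_digit.
Qed.

Let mA n : measurable (A n). Proof. exact: (measurable_requirement piP). Qed.

Lemma Pr_close_pair n : Pr (A n) = \prod_j close_prob j.
Proof.
rewrite (Pr_requirement piP); last exact: uniq_close_pair.
by apply: eq_bigr => j _; exact: prod_close_pair.
Qed.

(** In the coordinates where n and n' share the first k_j digits, the second
    event is dropped; in the others, both depend on different permutations. *)
Lemma Pr_two_close_pairs n n' : Pr (A n `&` A n') <=
  \prod_j (close_prob j *
    (if (n' %% b j ^ k j == n %% b j ^ k j)%N then 1 else close_prob j)).
Proof.
pose L j := close_pair n j ++
  if (n' %% b j ^ k j == n %% b j ^ k j)%N then [::] else close_pair n' j.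
have uL j : uniq (unzip1 (L j)).
  rewrite /L; case: eqP => [_|ne]; first by rewrite cats0 uniq_close_pair.
  rewrite /unzip1 map_cat cat_uniq.
  apply/and3P; split; [exact: uniq_close_pair| |exact: uniq_close_pair].
  apply/hasPn => a /close_pair_key[u [i [un ki ->]]].
  apply/negP => /close_pair_key[u' [i' [un' ki' /prefix_digits_inj[_ e]]]].
  by apply: ne; rewrite -un -un' (eqmod_expn_le ki e).
apply: (@le_trans _ _ (Pr (requirement pi L))).
  apply: Pr_le => [| |t [h h'] j q].
  - exact: measurableI.
  - exact: (measurable_requirement piP).
  - by rewrite mem_cat => /orP[/h //|]; case: ifP => // _; exact: h'.
rewrite (Pr_requirement piP) //; apply: ler_prod => j _.
apply/andP; split; first by apply: prodr_ge0 => q _; rewrite divr_ge0.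
rewrite big_cat prod_close_pair /=.
by case: ifP => _; rewrite ?big_nil ?prod_close_pair.
Qed.

(** The right-hand side bounds the relative variance of the number of close
    pairs: summing over n' the bound of [Pr_two_close_pairs] gives a product
    over the coordinates by the Chinese remainder theorem. *)
Lemma Pr_no_close_pair :
  Pr [set t | forall n : 'I_m, ~ A n t] <=
  \prod_j (1 + ((b j)%:R ^+ k j * close_prob j)^-1) - 1.
Proof.
have q0 := close_prob_gt0.
apply: (@second_moment _ _ _ P _ (fun n : 'I_m => A n) (\prod_j close_prob j)).
- by move=> n; exact: mA.
- by move=> n; exact: Pr_close_pair.
- by apply: prodr_gt0.
- by rewrite card_ord.
rewrite addrC subrK card_ord.
apply: (@le_trans _ _ (\sum_(n < m)
    \prod_j (close_prob j * (1 + (b j)%:R ^+ k j * close_prob j)))).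
  apply: ler_sum => n _.
  apply: (@le_trans _ _ (\sum_(n' < m) \prod_j (close_prob j *
      (if (n' %% b j ^ k j == n %% b j ^ k j)%N then 1 else close_prob j)))).
    by apply: ler_sum => n' _; exact: Pr_two_close_pairs.
  rewrite (eq_bigr (fun n' : 'I_m => \prod_j close_prob j * \prod_j
    (if (n' %% b j ^ k j == n %% b j ^ k j)%N then 1 else close_prob j)));
    last by move=> n' _; rewrite big_split.
  rewrite -mulr_sumr [X in _ <= X]big_split /=.
  apply: ler_wpM2l; first by apply: prodr_ge0 => j _; exact: ltW.
  have := @sum_residues_le R d (fun j => b j ^ k j)%N
    (fun j a => if (a == n %% b j ^ k j)%N then 1 else close_prob j)
    (coprime_pow k hcop) bk0.
  move=> /(_ _)/le_trans; apply.
    by move=> j a; case: ifP => // _; exact: ltW.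
  apply: ler_prod => j _; apply/andP; split.
    by apply: sumr_ge0 => a _; case: ifP => // _; exact: ltW.
  have nb : (n %% b j ^ k j < b j ^ k j)%N by rewrite ltn_pmod.
  rewrite (bigD1 (Ordinal nb)) //= eqxx lerD2l.
  apply: (@le_trans _ _ (\sum_(a < b j ^ k j) close_prob j)).
    rewrite [X in _ <= X](bigD1 (Ordinal nb)) //=; apply: ler_wpDl; first exact:
      ltW.
    by apply: ler_sum => a; rewrite -val_eqE /= => /negPf ->.
  by rewrite sumr_const card_ord -[_ *+ _]mulr_natl natrX.
rewrite sumr_const card_ord -[_ *+ _]mulr_natl.
have -> : m%:R = \prod_j (b j)%:R ^+ k j :> R.
  by rewrite natr_prod; apply: eq_bigr => j _; rewrite natrX.
rewrite expr2 -!big_split /= le_eqVlt; apply/orP; left; apply/eqP.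
apply: eq_bigr => j _; have B0 : (b j)%:R ^+ k j != 0 :> R.
  by rewrite expf_neq0 // pnatr_eq0 -lt0n ltnW.
by have := lt0r_neq0 (q0 j) => q1; field; rewrite q1 B0.
Qed.

Lemma close_pair_dist n t (r : R) : 0 <= r -> A n t ->
  (forall j, 2 / (b j)%:R ^+ ((k j).+1 + l j) <= r) ->
  `|x t n - x t (n + m)%N| <= r.
Proof.
move=> r0 At hr; rewrite norm_rV_le //; apply/forallP => j.
rewrite mxE [X in _ + X]mxE !scrambled_haltonE.
apply: le_trans (hr j); apply: digits_close => //.
- have /eq_cell e := esym (@shift_eqmod n j).
  have := At j (prefix_digits (b0 j) n (k j), perm_at2 _ _ _ _) (mem_head _ _).
  rewrite !inE /= => /andP[/eqP e0 /eqP e1].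
  rewrite /= -(e (b0 j) (fun a => @pi j a t)) -addnS; congr (_ + _)%N.
  rewrite /scrambled_digit e0 /=.
  have /(eq_prefix_digits (b0 j)) -> := @shift_eqmod n j.
  by rewrite e1.
- move=> r' h.
  have h1 q : q \in digit_run (b0 j) n (last_digit j) (k j).+1 (l j) ->
      @pi j q.1 t \in q.2.
    by move=> qL; apply: At; rewrite inE mem_cat qL orbT.
  have h2 q : q \in digit_run (b0 j) (n + m) (zero_digit j) (k j).+1 (l j) ->
      @pi j q.1 t \in q.2.
    by move=> qL; apply: At; rewrite inE mem_cat qL !orbT.
  have g1 := iffLR (digit_runP (b0 j) _ _ _ _ (fun a => @pi j a t)) h1.
  have g2 := iffLR (digit_runP (b0 j) _ _ _ _ (fun a => @pi j a t)) h2.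
  by rewrite g1 // g2.
Qed.

End SecondMoment.

(** * Choice of the levels *)

Section Levels.
Context (R : realType) (b : nat) (hb : (1 < b)%N).

Let bi0 i : 0 < (b%:R : R) ^+ i.
Proof. by rewrite exprn_gt0 // ltr0n ltnW. Qed.

Lemma exists_level (y : R) : 1 <= y ->
  exists k, b%:R ^+ k <= y < b%:R ^+ k.+1.
Proof.
move=> y1; exists (trunc_log b (Num.truncn y)).
have /andP[l u] := truncn_itv (le_trans ler01 y1).
have y0 : (0 < Num.truncn y)%N by rewrite truncn_gt0.
have /andP[l' u'] := trunc_log_bounds hb y0.
rewrite -!natrX; apply/andP; split.
  by apply: le_trans l; rewrite ler_nat.
by apply: lt_le_trans u _; rewrite ler_nat.
Qed.

Lemma exists_run_length_le k (r : R) : 0 < r ->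
  exists l, 2 / b%:R ^+ (k.+1 + l) <= r /\
            (l = 0%N \/ r < 2 / b%:R ^+ (k + l)).
Proof.
move=> r0; pose p l := 2 / (b%:R : R) ^+ (k.+1 + l) <= r.
have ex : exists l, p l.
  exists (Num.bound (2 / r)); rewrite /p ler_pdivrMr // mulrC -ler_pdivrMr //.
  apply: le_trans (ltW (archi_boundP _)) _; first by rewrite divr_ge0 // ltW.
  rewrite -natrX ler_nat ltnW //; apply: leq_trans (ltn_expl _ hb) _.
  by rewrite leq_exp2l // leq_addl.
have [l pl ml] := ex_minnP ex; exists l; split => //.
case: l pl ml => [|l] pl ml; [by left|right].
by rewrite ltNge -addSnnS; apply/negP => /ml; rewrite ltnn.
Qed.

End Levels.

Section Tail.
Context (R : realType) (d : nat) (b : 'I_d -> nat)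
  (hb : forall j, (1 < b j)%N)
  (hcop : forall i j, i != j -> coprime (b i) (b j))
  (disp : measure_display) (T : measurableType disp) (P : probability T R)
  (pi : forall j, seq 'I_(b j) -> T -> {perm 'I_(b j)})
  (piP : owen_permutations P pi).

Local Notation "'Pr' A" := (fine (P A)) (at level 10, A at level 8).
Local Notation x := (scrambled_halton R hb pi).

Lemma measurable_fun_ltP (f : T -> R) :
  (forall r, measurable [set t | f t < r]) -> measurable_fun setT f.
Proof.
move=> h; apply: (measurability _ (RGenInftyO.measurableE R)) => //.
move=> _ [_ [r ->] <-]; rewrite setTI; have := h r.
by congr measurable; apply/seteqP; split => t; rewrite /= in_itv.
Qed.

Lemma measurable_separation N : (1 < N)%N ->
  measurable_fun setT (fun t => separation (x t) N).
Proof.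
move=> N1; apply: measurable_fun_ltP => r.
exact: (measurable_separation_lt hb piP).
Qed.

Let kappa : R := \sum_j 4 * (b j)%:R ^+ 3 * (b j)`!%:R.

(** A level y in base b_j means b_j ^ k_j of order y. The bound is meant for
    y of order N ^ (1 / d), so that it is small as soon as r is large compared
    to N ^ (- 3 / (2 d)); the condition on y leaves room for the pairs
    (n, n + m), n < m, where m = prod_j b_j ^ k_j. *)
Lemma Pr_separation_gt N (y r : R) : 1 <= y -> 2 * y ^+ d <= N%:R -> 0 < r ->
  Pr [set t | r < separation (x t) N] <=
  2 ^+ d * kappa * (y^-1 + (r ^+ 2 * y ^+ 3)^-1).
Proof.
move=> y1 yN r0.
have y0 : 0 < y by apply: lt_le_trans y1.
have bi0 j i : 0 < ((b j)%:R : R) ^+ i by rewrite exprn_gt0 // ltr0n ltnW.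
have kap0 j : 0 <= 4 * (b j)%:R ^+ 3 * (b j)`!%:R :> R by rewrite !mulr_ge0
  ?exprn_ge0.
set s := y^-1 + (r ^+ 2 * y ^+ 3)^-1.
have s0 : 0 <= s by rewrite addr_ge0 // invr_ge0 ?mulr_ge0 ?exprn_ge0 // ltW.
have kappa0 : 0 <= kappa by apply: sumr_ge0.
have [k hk] := choice (fun j => exists_level (hb j) y1).
have [l hl] := choice (fun j => exists_run_length_le (hb j) (k j) r0).
set m := (\prod_j b j ^ k j)%N.
have mN : (2 * m <= N)%N.
  rewrite -(ler_nat R) natrM; apply: le_trans yN; rewrite ler_pM2l //.
  rewrite natr_prod -[X in _ ^+ X](card_ord d) -prodr_const.
  by apply: ler_prod => j _; rewrite natrX (ltW (bi0 _ _)) /=; case/andP: (hk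
    j).
have N1 : (1 < N)%N.
  apply: leq_trans mN; have : (0 < m)%N by rewrite prodn_gt0 // => j; rewrite
    expn_gt0 ltnW.
  by lia.
have mS : measurable [set t | r < separation (x t) N].
  rewrite -[X in measurable X]setTI.
  exact: (measurable_fun_ltr (measurable_cst r) (measurable_separation N1)).
(* If kappa * s > 1 the bound exceeds 1; otherwise the product of the
   1 + del j, with del j <= kappa * s, can be linearized. *)
have [big|small] := ltP 1 (kappa * s).
  apply: le_trans (Pr_le1 P mS) _; rewrite -mulrA.
  apply: le_trans (ltW big) _; rewrite ler_peMl //; first by rewrite mulr_ge0.
  by rewrite exprn_ege1 // ler1n.
pose del j : R := ((b j)%:R ^+ k j * close_prob R hb l j)^-1.
have del_le j : 0 <= del j <= kappa * s.
  have q0 := close_prob_gt0 R hb l j.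
  rewrite invr_ge0 mulr_ge0 ?(ltW q0) ?(ltW (bi0 _ _)) //=.
  apply: (@le_trans _ _ (4 * (b j)%:R ^+ 3 * (b j)`!%:R * s)); last first.
    by rewrite ler_wpM2r // /kappa (bigD1 j) //= lerDl; apply: sumr_ge0.
  set B := ((b j)%:R : R) ^+ k j; set F := ((b j)`!%:R : R).
  set X := ((b j)%:R : R) ^+ l j.
  have F1 : 1 <= F by rewrite /F ler1n fact_gt0.
  have B0 : 0 < B by exact: bi0. 
  have X0 : 0 < X by exact: bi0.
  have b1 : 1 <= (b j)%:R :> R by rewrite ler1n ltnW.
  have yB : y <= (b j)%:R * B by have /andP[_ /ltW] := hk j; rewrite exprS.
  have del1 : del j <= F * X ^+ 2 / B.
    rewrite /del invfM mulrC ler_wpM2r ?invr_ge0 ?(ltW B0) //.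
    have Fi : 0 < F^-1 * (X ^+ 2)^-1.
      by rewrite mulr_gt0 // invr_gt0 ?exprn_gt0 // (lt_le_trans ltr01).
    have -> : F * X ^+ 2 = (F^-1 / X ^+ 2)^-1 by rewrite invfM !invrK.
    rewrite lef_pV2 ?posrE //.
    by have := close_prob_ge R hb l j; rewrite -muln2 exprM.
  apply: (le_trans del1); rewrite mulrDr.
  have Bi : B^-1 <= (b j)%:R / y.
    by rewrite ler_pdivlMr // mulrC ler_pdivrMr.
  have [_ [l0|rl]] := hl j.
    apply: ler_wpDr; first by rewrite mulr_ge0 // invr_ge0 mulr_ge0 ?exprn_ge0
      // ltW.
    rewrite /X l0 expr0 expr1n mulr1.
    apply: (@le_trans _ _ (F * ((b j)%:R / y))); first by rewrite ler_wpM2l //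
      (le_trans ler01).
    rewrite mulrA [F * _]mulrC ler_wpM2r ?invr_ge0 ?(ltW y0) //.
    rewrite ler_wpM2r ?(le_trans ler01 F1) //.
    have : 1 <= (b j)%:R ^+ 2 :> R by rewrite exprn_ege1.
    by rewrite [_ ^+ 3]exprS; nra.
  apply: ler_wpDl; first by rewrite mulr_ge0 // invr_ge0 ltW.
  have XB : X * B * r <= 2.
    move: rl; rewrite exprD -/B -/X ltr_pdivlMr ?mulr_gt0 // => /ltW.
    by rewrite mulrC (mulrC X).
  have yB3 : y ^+ 3 <= (b j)%:R ^+ 3 * B ^+ 3.
    by rewrite -exprMn ler_pXn2r // ?nnegrE ?(ltW y0) // mulr_ge0 // ltW.
  have XB2 : (X * B * r) ^+ 2 <= 4.
    rewrite -[4]/(2 * 2)%:R natrM -expr2 ler_pXn2r // nnegrE ?mulr_ge0 // ltW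
      //.
  rewrite ler_pdivrMr // [X in _ <= X]mulrAC ler_pdivlMr; last first.
    by rewrite mulr_gt0 ?exprn_gt0.
  have -> : F * X ^+ 2 * (r ^+ 2 * y ^+ 3) = F * (X * r) ^+ 2 * y ^+ 3 by ring.
  apply: (@le_trans _ _ (F * (X * r) ^+ 2 * ((b j)%:R ^+ 3 * B ^+ 3))).
    by rewrite ler_wpM2l // mulr_ge0 ?exprn_ge0 ?mulr_ge0 ?(le_trans ler01 F1)
      ?(ltW X0) ?(ltW r0).
  have -> : F * (X * r) ^+ 2 * ((b j)%:R ^+ 3 * B ^+ 3) =
    (X * B * r) ^+ 2 * ((b j)%:R ^+ 3 * F * B) by ring.
  have -> : 4 * (b j)%:R ^+ 3 * F * B = 4 * ((b j)%:R ^+ 3 * F * B) by ring.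
  by rewrite ler_wpM2r // !mulr_ge0 ?exprn_ge0 ?(le_trans ler01 F1) ?(ltW B0).
apply: (@le_trans _ _ (\prod_j (1 + del j) - 1)).
  apply: le_trans (Pr_no_close_pair hb hcop piP k l).
  apply: Pr_le => //.
    rewrite (_ : [set t | _] = \bigcap_(n in [set: 'I_m])
        ~` requirement pi (close_pair hb k l n)); last first.
      by apply/seteqP; split => [t h n _|t h n]; apply: h.
    apply: fin_bigcap_measurable => // n _; apply: measurableC.
    exact: (measurable_requirement piP).
  move=> t /= rs n An; move: rs; rewrite ltNge => /negP; apply.
  apply: le_trans (close_pair_dist (ltW r0) An (fun j => (hl j).1)).
  apply: ge_inf; first by exists 0 => _ [u [u' [_ _ ->]]].
  have : (n < m)%N := ltn_ord n; rewrite /m => nm.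
  by exists n, (n + \prod_j b j ^ k j)%N; split => //; lia.
apply: le_trans (_ : (1 + kappa * s) ^+ d - 1 <= _).
  rewrite lerD2r -[X in _ ^+ X](card_ord d) -prodr_const.
  apply: ler_prod => j _; have /andP[p0 p1] := del_le j.
  by rewrite addr_ge0 //= lerD2l.
rewrite -mulrA; set z := kappa * s; have z0 : 0 <= z by rewrite mulr_ge0.
suff h i : (1 + z) ^+ i <= 1 + (2 ^+ i - 1) * z by have := h d; lra.
elim: i => [|i IH]; first by rewrite !expr0 subrr mul0r addr0.
rewrite exprS; apply: (@le_trans _ _ ((1 + z) * (1 + (2 ^+ i - 1) * z))).
  by rewrite ler_wpM2l // addr_ge0.
have : 1 <= (2 ^+ i : R) by rewrite exprn_ege1 // ler1n.
rewrite exprS; set w := 2 ^+ i => w1.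
have : (w - 1) * z * z <= (w - 1) * z by rewrite ler_piMr // mulr_ge0 //
  subr_ge0.
by rewrite -/z in small *; lra.
Qed.

(** * Covering radius *)

Lemma covering_radius_bounds t N (y : R) : (0 < d)%N -> (0 < N)%N -> 1 <= y ->
  y ^+ d = N%:R ->
  (4 * y)^-1 <= covering_radius (x t) N <= (\sum_j b j)%:R / y.
Proof.
move=> hd N0 y1 yN; have y0 : 0 < y by apply: lt_le_trans y1.
have x01 := @scrambled_halton_itv R d b hb T pi t.
apply/andP; split.
  have /andP[l u] := truncn_itv (ltW y0).
  have NK : (N < (Num.truncn y).+1 ^ d)%N.
    by rewrite -(ltr_nat R) natrX -yN ltrXn2r // ?ltW // -lt0n.
  apply: le_trans (covering_radius_ge x01 N0 NK).
  rewrite lef_pV2 ?posrE ?mulr_gt0 // -natr1; lra.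
have [k hk] := choice (fun j => exists_level (hb j) y1).
apply: (@covering_radius_cells _ _ _ _ hcop _ _ _ k) => [|j|].
- rewrite -(ler_nat R) -yN natr_prod -[X in _ <= _ ^+ X](card_ord d)
  -prodr_const.
  by apply: ler_prod => j _; rewrite natrX exprn_ge0 //=; case/andP: (hk j).
- have B0 : 0 < ((b j)%:R : R) ^+ k j by rewrite exprn_gt0 // ltr0n ltnW.
  rewrite ler_pdivlMr // mulrC ler_pdivrMr //.
  have /andP[_ /ltW h] := hk j; apply: (le_trans h).
  by rewrite exprS ler_pM2r // ler_nat (bigD1 j) //= leq_addr.
- by rewrite divr_ge0 // ltW.
Qed.

(** The distance to the points is 1-Lipschitz in z, so that the points of the
    grids of mesh 1 / (K + 1) are enough to compute the covering radius, which
    is thus a countable supremum. *)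
Lemma measurable_covering_radius N : (0 < N)%N ->
  measurable_fun setT (fun t => covering_radius (x t) N).
Proof.
move=> N0.
have x01 t := @scrambled_halton_itv R d b hb T pi t.
pose dist (z : 'rV[R]_d) t := inf [set `|z - x t n| | n in [set n | (n < N)%N]].
have md z : measurable_fun setT (dist z).
  apply: measurable_fun_ltP => r.
  rewrite (_ : [set t | _] = \bigcup_(n in [set n | (n < N)%N])
     [set t | `|z - x t n| < r]).
    apply: bigcup_measurable => n _.
    have [r0|r0] := ltP 0 r; last first.
      rewrite (_ : [set t | _] = set0) //; apply/seteqP; split => t //= h.
      by have := le_lt_trans (normr_ge0 _) h; rewrite ltNge r0.
    rewrite (_ : [set t | _] = \bigcap_(j in [set: 'I_d])
       [set t | `|z 0 j - x t n 0 j| < r]).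
      apply: fin_bigcap_measurable => // j _.
      rewrite -[X in measurable X]setTI; apply: measurable_fun_ltr => //.
      apply: measurableT_comp => //; apply: measurable_funB => //.
      exact: (measurable_scrambled_halton hb piP).
    apply/seteqP; split=> t; rewrite /= norm_rV_lt //.
      by move=> /forallP h j _; have := h j; rewrite mxE [X in _ + X]mxE.
    by move=> h; apply/forallP => j; rewrite mxE [X in _ + X]mxE; exact: h.
  apply/seteqP; split => t; last first.
    by move=> [n nN h]; apply: le_lt_trans h; exact: dist_to_le.
  move=> /= h; apply: contrapT => no; move: h; apply/negP; rewrite -leNgt.
  apply: dist_to_ge => // n nN; rewrite leNgt; apply/negP => h.
  by apply: no; exists n.
pose grid K (f : {ffun 'I_d -> 'I_K.+2}) : 'rV[R]_d :=
  \row_j ((f j)%:R / K.+1%:R).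
have grid01 K f j : 0 <= grid K f 0 j <= 1.
  rewrite mxE divr_ge0 //= ler_pdivrMr // mul1r ler_nat.
  by rewrite -ltnS; exact: ltn_ord.
move=> _; apply: (measurability _ (RGenOInfty.measurableE R)) => //.
move=> _ [_ [c ->] <-]; rewrite setTI.
rewrite (_ : _ @^-1` _ = \bigcup_(K in [set: nat]) \bigcup_(f in [set: _])
   [set t | c < dist (@grid K f) t]).
  apply: bigcup_measurable => K _; apply: fin_bigcup_measurable => // f _.
  rewrite -[X in measurable X]setTI.
  exact: (measurable_fun_ltr (measurable_cst c) (md _)).
apply/seteqP; split => t; rewrite /= in_itv /= andbT; last first.
  move=> [K _ [f _ h]]; apply: lt_le_trans h _.
  exact: (dist_to_le_covering_radius (x01 t)).
move=> h; have [z z01 cz] : exists2 z : 'rV[R]_d,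
    (forall j, 0 <= z 0 j <= 1) & c < dist z t.
  apply: contrapT => no; move: h; apply/negP; rewrite -leNgt.
  apply: ge_sup; first by exists (dist 0 t), 0 => // j; rewrite mxE lexx ler01.
  move=> _ [z z01 ->]; rewrite leNgt; apply/negP => cz.
  by apply: no; exists z.
have e0 : 0 < dist z t - c by rewrite subr_gt0.
pose K := Num.bound (dist z t - c)^-1.
have Ke : K.+1%:R^-1 < dist z t - c.
  rewrite invf_plt ?posrE //.
  apply: lt_le_trans (archi_boundP _) _; first by rewrite invr_ge0 ltW.
  by rewrite ler_nat leqnSn.
pose f : {ffun 'I_d -> 'I_K.+2} := [ffun j => inord (Num.truncn (z 0 j *
  K.+1%:R))].
exists K => //; exists f => //=.
have zf : `|grid K f - z| <= K.+1%:R^-1.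
  rewrite norm_rV_le //; apply/forallP => j; rewrite !mxE ffunE.
  have /andP[z0 z1] := z01 j.
  have w0 : 0 <= z 0 j * K.+1%:R by rewrite mulr_ge0.
  have /andP[l u] := truncn_itv w0.
  rewrite inordK; last first.
    rewrite ltnS -(ler_nat R); apply: le_trans l _.
    by rewrite -[X in _ <= X]mul1r ler_wpM2r.
  set q := Num.truncn _ in l u *.
  rewrite -[z 0 j](mulfK (lt0r_neq0 (ltr0Sn R K))) -mulrBl normrM.
  rewrite [X in _ * X]ger0_norm // ler_piMl // ler_norml.
  by move: u; rewrite -natr1; lra.
have : c < dist z t - K.+1%:R^-1 by rewrite ltrBrDr addrC -ltrBrDr.
move/lt_le_trans; apply; apply: dist_to_ge => // n nN.
rewrite lerBlDr; apply: le_trans (dist_to_le _ z nN) _.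
rewrite -[X in `|X|](_ : (grid K f - x t n) - (grid K f - z) = _); last first.
  by rewrite opprB addrC addrA subrK.
apply: le_trans (ler_normB _ _) _.
by rewrite lerD2l.
Qed.

End Tail.

(** * Bounds in probability *)

Section Powers.
Context (R : realType).

Lemma powRXn (a s : R) n : (a `^ s) ^+ n = a `^ (s * n%:R).
Proof. by rewrite -powR_mulrn ?powR_ge0 // -powRrM. Qed.

Lemma trunc_log_le_ln N : (1 < N)%N ->
  (trunc_log 2 N).+1%:R <= 2 / ln 2 * ln N%:R :> R.
Proof.
move=> N1; have ln2 : 0 < ln 2 :> R by rewrite ln_gt0 // ltr1n.
have N0 : (0 < N)%N by apply: ltnW.
rewrite mulrAC ler_pdivlMr //.
have h1 : ln 2 <= ln N%:R :> R.
  by rewrite ler_ln ?posrE ?ltr0n // ler_nat.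
have h2 : (trunc_log 2 N)%:R * ln 2 <= ln N%:R :> R.
  rewrite mulr_natl -lnXn // ler_ln ?posrE ?exprn_gt0 ?ltr0n //.
  by rewrite -natrX ler_nat; have /andP[] := trunc_log_bounds (isT : (1 < 2)%N)
    N0.
by rewrite -natr1 mulrDl mul1r; lra.
Qed.

Lemma ln_le_powR (s a : R) : 0 < s -> 1 <= a -> ln a <= a `^ s / s.
Proof.
move=> s0 a1; have a0 : 0 < a by apply: lt_le_trans a1.
by rewrite ler_pdivlMr // mulrC -ln_powR ltW // ln_sublinear // powR_gt0.
Qed.

End Powers.

Section Bounds.
Context (R : realType) (d : nat) (hd : (0 < d)%N) (b : 'I_d -> nat)
  (hb : forall j, (1 < b j)%N)
  (hcop : forall i j, i != j -> coprime (b i) (b j)).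

Local Notation theta := (3 / (2 * d%:R) : R).
Local Notation lambda := ((d%:R - 1) / (2 * d%:R) : R).

Let dR : 0 < d%:R :> R. Proof. by rewrite ltr0n. Qed.

Let predd : d%:R - 1 = d.-1%:R :> R.
Proof. by rewrite -[in LHS](prednK hd) -natr1 addrK. Qed.

(** Constant of the bound on the probability of a small separation; the power
    of 2 / ln 2 converts binary logarithms. *)
Definition small_const : R :=
  4 * (2 ^+ d * \prod_j (b j)%:R ^+ 4) * (2 / ln 2) ^+ d.-1.

Lemma small_const_gt0 : 0 < small_const.
Proof.
rewrite !mulr_gt0 ?exprn_gt0 ?divr_gt0 ?ln_gt0 ?ltr1n //.
by apply: prodr_gt0 => j _; rewrite exprn_gt0 // ltr0n ltnW.
Qed.

(** Constant of the bound on the probability of a large separation; the factor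
    8 accounts for the level (N / 2) ^ (1 / d) instead of N ^ (1 / d). *)
Definition large_const : R :=
  8 * (2 ^+ d * \sum_j 4 * (b j)%:R ^+ 3 * (b j)`!%:R).

Lemma large_const_gt0 : 0 < large_const.
Proof.
rewrite !mulr_gt0 ?exprn_gt0 // (bigD1 (Ordinal hd)) //=.
apply: ltr_wpDr; first by apply: sumr_ge0 => j _; rewrite !mulr_ge0 ?exprn_ge0.
by rewrite !mulr_gt0 ?exprn_gt0 ?ltr0n ?fact_gt0 // ltnW.
Qed.

Section Fixed.
Context (disp : measure_display) (T : measurableType disp)
  (P : probability T R) (pi : forall j, seq 'I_(b j) -> T -> {perm 'I_(b j)})
  (piP : owen_permutations P pi).

Local Notation "'Pr' A" := (fine (P A)) (at level 10, A at level 8).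
Local Notation x := (scrambled_halton R hb pi).

Lemma Pr_separation_lt_ln N (r : R) : (1 < N)%N -> 0 < r ->
  Pr [set t | separation (x t) N < r] <=
  small_const * (r ^+ d.*2 * N%:R ^+ 3 * ln N%:R ^+ d.-1).
Proof.
move=> N1 r0; apply: le_trans (Pr_separation_lt hb hcop piP hd N1 r0) _.
have lnN : 0 <= ln N%:R :> R by rewrite ln_ge0 // ler1n ltnW.
rewrite /small_const -[X in _ <= X]mulrA ler_wpM2l //.
  rewrite !mulr_ge0 ?exprn_ge0 // prodr_ge0 // => j _; exact: exprn_ge0.
rewrite [X in _ <= X]mulrCA ler_wpM2l ?mulr_ge0 ?exprn_ge0 ?(ltW r0) //.
have l2 : 0 <= 2 / ln 2 :> R by rewrite divr_ge0 // ln_ge0 // ler1n.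
rewrite -exprMn lerXn2r ?nnegrE //; first exact: mulr_ge0.
exact: trunc_log_le_ln.
Qed.

Lemma Pr_separation_small N (u : R) : (1 < N)%N -> 1 <= u ->
  Pr [set t | separation (x t) N <
    N%:R `^ (- theta) * ln N%:R `^ (- lambda) / u] <= small_const / u.
Proof.
move=> N1 u1; have u0 : 0 < u by apply: lt_le_trans u1.
have N0 : 0 < N%:R :> R by rewrite ltr0n ltnW.
have l0 : 0 < ln N%:R :> R by rewrite ln_gt0 // ltr1n.
apply: le_trans (Pr_separation_lt_ln N1 _) _.
  by rewrite divr_gt0 // mulr_gt0 // powR_gt0.
rewrite ler_pM2l ?small_const_gt0 // !exprMn !powRXn.
have -> : - theta * d.*2%:R = - 3%:R.
  by rewrite -muln2 natrM; field; rewrite gt_eqF.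
have -> : - lambda * d.*2%:R = - d.-1%:R.
  by rewrite -predd -muln2 natrM; field; rewrite gt_eqF.
rewrite !powRN !powR_mulrn ?(ltW N0) ?(ltW l0) //.
rewrite [X in X <= _](_ : _ = u^-1 ^+ d.*2); last first.
  by field; rewrite !expf_neq0 ?gt_eqF.
rewrite -[X in _ <= X]expr1 ler_wiXn2l ?invr_ge0 ?(ltW u0) ?invf_le1 //.
by rewrite double_gt0.
Qed.

(** The logarithms are absorbed by part of the power of N. *)
Lemma Pr_separation_small_pow N (e : R) : (1 < N)%N -> 0 < e ->
  Pr [set t | separation (x t) N < N%:R `^ (- theta - e)] <=
  small_const / e ^+ d.-1 * N%:R `^ (- e).
Proof.
move=> N1 e0.
have N0 : 0 < N%:R :> R by rewrite ltr0n ltnW.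
have N1R : 1 <= N%:R :> R by rewrite ler1n ltnW.
have l0 : 0 <= ln N%:R :> R by rewrite ln_ge0.
apply: le_trans (Pr_separation_lt_ln N1 _) _; first by rewrite powR_gt0.
rewrite -[X in _ <= X]mulrA ler_pM2l ?small_const_gt0 //.
apply: (@le_trans _ _ ((N%:R `^ (- theta - e)) ^+ d.*2 * N%:R ^+ 3 *
    (N%:R `^ e / e) ^+ d.-1)).
  rewrite ler_wpM2l ?mulr_ge0 ?exprn_ge0 ?powR_ge0 //.
  by rewrite lerXn2r ?nnegrE ?divr_ge0 ?powR_ge0 ?(ltW e0) ?ln_le_powR.
rewrite exprMn !powRXn exprVn mulrA mulrC ler_wpM2l ?invr_ge0 ?exprn_ge0 ?(ltW
  e0) //.
rewrite -powR_mulrn ?(ltW N0) // -!powRD ?(gt_eqF N0) ?implybT //.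
rewrite ler_powR // -predd -muln2 natrM.
have -> : (- theta - e) * (d%:R * 2) + 3%:R + e * (d%:R - 1) = - e * (d%:R + 1).
  by field; rewrite gt_eqF.
by rewrite mulNr lerN2 ler_peMr ?(ltW e0) // lerDr ltW.
Qed.

Lemma Pr_separation_large N (u : R) : (1 < N)%N -> 0 < u ->
  Pr [set t | u * N%:R `^ (- theta) < separation (x t) N] <=
  large_const * (N%:R `^ (- (1 / d%:R)) + (u ^+ 2)^-1).
Proof.
move=> N1 u0; have N0 : 0 < N%:R :> R by rewrite ltr0n ltnW.
pose y : R := (N%:R / 2) `^ (1 / d%:R).
have N2 : 1 <= N%:R / 2 :> R by rewrite ler_pdivlMr // mul1r ler_nat.
have i0 : 0 <= 1 / d%:R :> R by rewrite divr_ge0.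
have i1 : 1 / d%:R <= 1 :> R by rewrite ler_pdivrMr // mul1r ler1n.
have y1 : 1 <= y.
  by rewrite -[X in X <= _](powRr0 (N%:R / 2)) ler_powR.
have y0 : 0 < y by apply: lt_le_trans y1.
have yd : 2 * y ^+ d <= N%:R.
  rewrite powRXn divfK ?gt_eqF // powRr1 ?divr_ge0 //.
  by rewrite mulrC divfK.
have s0 : 0 < u * N%:R `^ (- theta) by rewrite mulr_gt0 // powR_gt0.
apply: le_trans (Pr_separation_gt hb hcop piP y1 yd s0) _.
rewrite /large_const [8 * _]mulrC -[_ * 8 * _]mulrA ler_wpM2l //.
  rewrite mulr_ge0 ?exprn_ge0 // sumr_ge0 // => j _; by rewrite !mulr_ge0
    ?exprn_ge0.
have two : 1 <= (2 : R) `^ (1 / d%:R) <= 2.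
  rewrite -{1}(powRr0 2) ler_powR ?ler1n //= -[X in _ <= X]powRr1 //.
  by rewrite ler_powR ?ler1n.
set z := 2 `^ (1 / d%:R) in two; have /andP[z1 z2] := two.
have z0 : 0 < z by apply: lt_le_trans z1.
have yE : y = N%:R `^ (1 / d%:R) / z.
  by rewrite /y /z powRM ?invr_ge0 // -powRN -[2^-1]powR_inv1 // -powRrM mulN1r.
clearbody z; have v0 : 0 < N%:R `^ (1 / d%:R) :> R by rewrite powR_gt0.
rewrite mulrDr; apply: lerD.
  rewrite yE invfM invrK powRN mulrC ler_wpM2r ?invr_ge0 ?(ltW v0) //.
  by apply: le_trans z2 _; rewrite ler_nat.
have -> : (u * N%:R `^ (- theta)) ^+ 2 * y ^+ 3 = u ^+ 2 / z ^+ 3.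
  rewrite yE !exprMn !powRXn exprVn -mulrA; congr (_ * _).
  rewrite mulrA -powRD ?(gt_eqF N0) ?implybT //.
  rewrite (_ : - theta * 2 + 1 / d%:R * 3 = 0) ?powRr0 ?mul1r //.
  by field; rewrite gt_eqF.
rewrite invfM invrK mulrC ler_wpM2r ?invr_ge0 ?exprn_ge0 ?(ltW u0) //.
have -> : 8 = 2 ^+ 3 :> R by rewrite -natrX.
by rewrite lerXn2r ?nnegrE // ltW.
Qed.

End Fixed.

End Bounds.

(** * Almost sure bounds *)

Lemma geometric_sum_le (R : realFieldType) (q : R) n : 0 <= q < 1 ->
  \sum_(i < n) q ^+ i <= (1 - q)^-1.
Proof.
move=> /andP[q0 q1]; rewrite -[X in _ <= X]div1r ler_pdivlMr ?subr_gt0 //.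
suff -> : (\sum_(i < n) q ^+ i) * (1 - q) = 1 - q ^+ n.
  by rewrite gerBl exprn_ge0.
elim: n => [|n IH]; first by rewrite big_ord0 mul0r expr0 subrr.
by rewrite big_ord_recr /= mulrDl IH exprSr; ring.
Qed.

(** Borel-Cantelli: along the powers of 2, a power decay is geometric. *)
Lemma ae_eventually_dyadic (R : realType) (disp : measure_display)
    (T : measurableType disp) (P : probability T R) (B : nat -> set T)
    (C eta : R) : 0 < eta ->
  (forall N, (1 < N)%N -> measurable (B N)) ->
  (forall N, (1 < N)%N -> fine (P (B N)) <= C * N%:R `^ (- eta)) ->
  {ae P, forall t, exists i0, forall i, (i0 <= i)%N -> ~ B (2 ^ i)%N t}.
Proof.
move=> eta0 mB PB.
pose F i := B (2 ^ i.+1)%N.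
have F1 i : (1 < 2 ^ i.+1)%N by rewrite -{1}(expn0 2) ltn_exp2l.
have mF i : measurable (F i) by exact: mB.
have C0 : 0 <= C.
  have := le_trans (fine_ge0 (measure_ge0 P _)) (PB 2%N isT).
  by rewrite pmulr_lge0 // powR_gt0.
pose q : R := 2 `^ (- eta).
have q01 : 0 <= q < 1.
  rewrite powR_ge0 /= /q powRN invf_lt1 ?powR_gt0 //.
  have : 1 `^ eta < 2 `^ eta :> R.
    by apply: gt0_ltr_powR; rewrite ?nnegrE ?ltr1n.
  by rewrite powR1.
suff : P (lim_sup_set F) = 0%E.
  move=> L0; exists (lim_sup_set F); split => //.
    by apply: bigcap_measurable => // n _; apply: bigcup_measurable.
  move=> t /= nt n _; apply: contrapT => h; apply: nt; exists n.+1 => i ni Bi.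
  apply: h; exists i.-1 => /=; first by rewrite -ltnS prednK //; case: i ni
    {Bi}.
  by rewrite /F prednK //; case: i ni {Bi}.
apply: lim_sup_set_cvg0 => //.
apply: (@le_lt_trans _ _ (C * (1 - q)^-1)%:E); last exact: ltry.
apply: lime_le; first by apply: is_cvg_nneseries => n _ _; exact: measure_ge0.
near=> n; rewrite big_mkord.
apply: (@le_trans _ _ (\sum_(i < n) (C * q ^+ i)%:E)%E).
  apply: lee_sum => i _; rewrite -[X in (X <= _)%E]fineK ?fin_num_measure //
    lee_fin.
  apply: le_trans (PB _ (F1 i)) _; rewrite ler_wpM2l //.
  rewrite natrX -powR_mulrn // powRAC powR_mulrn ?powR_ge0 // -/q.
  by rewrite exprS ler_piMl ?exprn_ge0 //; case/andP: q01 => // _ /ltW.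
rewrite sumEFin lee_fin -mulr_sumr ler_wpM2l //; exact: geometric_sum_le.
Unshelve. all: end_near. Qed.

Lemma separation_decr (R : realType) (d : nat) (x : nat -> 'rV[R]_d) N N' :
  (1 < N)%N -> (N <= N')%N -> separation x N' <= separation x N.
Proof.
move=> N1 NN; apply: lb_le_inf; first by exists `|x 0 - x 1|, 0%N, 1%N.
move=> _ [n [n' [nn nN ->]]]; apply: ge_inf.
  by exists 0 => _ [m [m' [_ _ ->]]].
by exists n, n'; split => //; exact: leq_trans NN.
Qed.

Lemma separation_ge0 (R : realType) (d : nat) (x : nat -> 'rV[R]_d) N :
  0 <= separation x N.
Proof.
have [[y Ey]|E0] := pselect ([set r | exists n n',
    [/\ (n < n')%N, (n' < N)%N & r = `|x n - x n'|]] !=set0).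
  apply: lb_le_inf; first by exists y.
  by move=> _ [n [n' [_ _ ->]]].
by move: E0 => /set0P /negP /negPn /eqP E0; rewrite /separation E0 inf0.
Qed.

(** Monotonicity extends the bounds at the powers of 2 to all N; the factor is
    the price for the distance to the next power. *)
Lemma dyadic_bounds (R : realType) (X : nat -> R) (th e : R) (i0 : nat) :
  0 < e -> e <= th ->
  (forall N N', (1 < N)%N -> (N <= N')%N -> X N' <= X N) ->
  (forall i, (i0 <= i)%N -> (2 ^ i)%:R `^ (- th - e) <= X (2 ^ i)%N
     <= (2 ^ i)%:R `^ (- th + e)) ->
  \forall N \near \oo, (2 `^ (th + th))^-1 * N%:R `^ (- th - e) <= X N
     <= 2 `^ (th + th) * N%:R `^ (- th + e).
Proof.
move=> e0 eth mX h; near=> N.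
have N1 : (2 ^ i0.+1 <= N)%N by near: N; exact: nbhs_infty_ge.
have N0 : (0 < N)%N by apply: leq_trans N1; rewrite expn_gt0.
have /andP[l u] := trunc_log_bounds (isT : (1 < 2)%N) N0.
set i := trunc_log 2 N in l u.
have ii : (i0 < i)%N.
  by rewrite -ltnS -(ltn_exp2l _ _ (isT : (1 < 2)%N)); exact: leq_ltn_trans u.
have Ni : (1 < 2 ^ i)%N by rewrite -{1}(expn0 2) ltn_exp2l // (leq_trans _ ii).
have NR : 0 < N%:R :> R by rewrite ltr0n.
apply/andP; split.
  apply: (@le_trans _ _ (X (2 ^ i.+1)%N)); last first.
    by apply: mX; [exact: leq_trans Ni l|exact: ltnW].
  have /andP[+ _] := h i.+1 (leqW (ltnW ii)); apply: le_trans.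
  apply: (@le_trans _ _ ((2 * N%:R) `^ (- th - e))); last first.
    rewrite -opprD !powRN lef_pV2 ?posrE ?powR_gt0 ?mulr_gt0 ?ltr0n ?expn_gt0
      //.
    rewrite ge0_ler_powR ?nnegrE ?addr_ge0 ?(ltW e0) ?(le_trans (ltW e0) eth)
      //.
    by rewrite -natrM ler_nat expnS leq_mul2l.
  rewrite powRM // -powRN ler_wpM2r ?powR_ge0 // ler_powR ?ler1n //.
  by lra.
apply: (@le_trans _ _ (X (2 ^ i)%N)); first exact: mX.
have /andP[_ +] := h i (ltnW ii); move/le_trans; apply.
apply: (@le_trans _ _ ((N%:R / 2) `^ (- th + e))).
  have -> : - th + e = - (th - e) by rewrite opprB addrC.
  rewrite !powRN.
  rewrite lef_pV2 ?posrE ?powR_gt0 ?divr_gt0 ?ltr0n ?expn_gt0 //.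
  rewrite ge0_ler_powR ?nnegrE ?subr_ge0 // ?divr_ge0 //.
  by rewrite ler_pdivrMr // -natrM ler_nat -expnSr ltnW.
rewrite powRM ?invr_ge0 // mulrC ler_wpM2r ?powR_ge0 //.
rewrite -powR_inv1 // -powRrM mulN1r ler_powR ?ler1n //.
by lra.
Unshelve. all: end_near. Qed.

(** * From power bounds to logarithmic limits *)

Lemma log_limit (R : realType) (X : nat -> R) (kap dlt : R) : 0 < dlt ->
  (forall p : nat, exists2 C : R, 0 < C & \forall N \near \oo,
     C^-1 * N%:R `^ (kap - dlt / p.+1%:R) <= X N
       <= C * N%:R `^ (kap + dlt / p.+1%:R)) ->
  (lne (X N)%:E / (ln N%:R)%:E)%E @[N --> \oo] --> kap%:E.
Proof.
move=> d0 h.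
apply: (@cvg_trans _ ((ln (X N) / ln N%:R)%:E @[N --> \oo])).
  apply: near_eq_cvg; have [C C0 hC] := h 0%N.
  near=> N.
  have N1 : (1 < N)%N by near: N; exact: nbhs_infty_gt.
  have : 0 < X N.
    have /andP[+ _] : C^-1 * N%:R `^ (kap - dlt / 1%:R) <= X N
       <= C * N%:R `^ (kap + dlt / 1%:R) by near: N.
    by apply: lt_le_trans; rewrite mulr_gt0 ?invr_gt0 ?powR_gt0 // ltr0n ltnW.
  move=> X0; rewrite lne_EFin // inver.
  by rewrite gt_eqF ?ln_gt0 ?ltr1n // EFinM.
apply: cvg_EFin; first by near=> N.
apply/cvgrPdist_le => e e0.
pose p := Num.bound (dlt / (e / 2)).
have pe : dlt / p.+1%:R <= e / 2.
  rewrite ler_pdivrMr // mulrC -ler_pdivrMr ?divr_gt0 //.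
  apply: le_trans (ltW (archi_boundP _)) _; first by rewrite !divr_ge0 // ltW.
  by rewrite ler_nat leqnSn.
have [C C0 hC] := h p.
near=> N.
have N1 : (1 < N)%N by near: N; exact: nbhs_infty_gt.
have NR : 0 < N%:R :> R by rewrite ltr0n ltnW.
have l0 : 0 < ln N%:R :> R by rewrite ln_gt0 // ltr1n.
have lC : `|ln C| <= e / 2 * ln N%:R.
  rewrite mulrC -ler_pdivrMr ?divr_gt0 //; set z := _ / _.
  have zN : expR z <= N%:R.
    apply: le_trans (ltW (archi_boundP (expR_ge0 z))) _.
    by rewrite ler_nat; near: N; exact: nbhs_infty_ge.
  by rewrite -[z]expRK ler_ln ?posrE ?expR_gt0.
have /andP[lo up] : C^-1 * N%:R `^ (kap - dlt / p.+1%:R) <= X N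
       <= C * N%:R `^ (kap + dlt / p.+1%:R) by near: N.
have X0 : 0 < X N by apply: lt_le_trans lo; rewrite mulr_gt0 ?invr_gt0
  ?powR_gt0.
have lo' : - ln C + (kap - dlt / p.+1%:R) * ln N%:R <= ln (X N).
  rewrite -lnV ?posrE // -ln_powR -lnM ?posrE ?invr_gt0 ?powR_gt0 //.
  by rewrite ler_ln ?posrE // mulr_gt0 ?invr_gt0 ?powR_gt0.
have up' : ln (X N) <= ln C + (kap + dlt / p.+1%:R) * ln N%:R.
  rewrite -ln_powR -lnM ?posrE ?powR_gt0 //.
  by rewrite ler_ln ?posrE // mulr_gt0 ?powR_gt0.
have pl : dlt / p.+1%:R * ln N%:R <= e / 2 * ln N%:R by rewrite ler_pM2r.
rewrite /= -[kap](mulfK (lt0r_neq0 l0)) -mulrBl normrM normfV (gtr0_norm l0).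
rewrite ler_pdivrMr // ler_norml.
move: lC; rewrite ler_norml => /andP[lC1 lC2].
move: lo' up' pl; set L := ln N%:R in lC1 lC2 *; set v := dlt / _ => lo' up' pl.
set lx := ln (X N) in lo' up' *; set lc := ln C in lC1 lC2 lo' up' *; clearbody
  L v lx lc; nra.
Unshelve. all: end_near. Qed.

Section AlmostSure.
Context (R : realType) (d : nat) (hd : (0 < d)%N) (b : 'I_d -> nat)
  (hb : forall j, (1 < b j)%N)
  (hcop : forall i j, i != j -> coprime (b i) (b j))
  (disp : measure_display) (T : measurableType disp) (P : probability T R)
  (pi : forall j, seq 'I_(b j) -> T -> {perm 'I_(b j)})
  (piP : owen_permutations P pi).

Local Notation x := (scrambled_halton R hb pi).
Local Notation theta := (3 / (2 * d%:R) : R).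

Let dR : 0 < d%:R :> R. Proof. by rewrite ltr0n. Qed.

Let theta0 : 0 < theta. Proof. by rewrite divr_gt0 // mulr_gt0. Qed.

Lemma ae_separation_bounds (e : R) : 0 < e -> e <= theta ->
  {ae P, forall t, \forall N \near \oo,
    (2 `^ (theta + theta))^-1 * N%:R `^ (- theta - e) <= separation (x t) N
     <= 2 `^ (theta + theta) * N%:R `^ (- theta + e)}.
Proof.
move=> e0 eth.
have mS N : (1 < N)%N -> measurable_fun setT (fun t => separation (x t) N).
  exact: (measurable_separation hb piP).
have small := @ae_eventually_dyadic R disp T P
  (fun N => [set t | separation (x t) N < N%:R `^ (- theta - e)])
  (small_const R b / e ^+ d.-1) e e0 _ _.
have {}small := small
  (fun N N1 => measurable_separation_lt hb piP _ N1)
  (fun N N1 => Pr_separation_small_pow hd hb hcop piP N1 e0).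
(* The two terms of the bound on a large separation, at u = N ^ e. *)
pose eta := Num.min (1 / d%:R) (2 * e) : R.
have eta0 : 0 < eta by rewrite lt_min divr_gt0 //= mulr_gt0.
have large := @ae_eventually_dyadic R disp T P
  (fun N => [set t | N%:R `^ e * N%:R `^ (- theta) < separation (x t) N])
  (large_const R b * 2) eta eta0.
have mL N : (1 < N)%N -> measurable
    [set t | N%:R `^ e * N%:R `^ (- theta) < separation (x t) N].
  move=> N1; rewrite -[X in measurable X]setTI.
  exact: (measurable_fun_ltr (measurable_cst _) (mS N N1)).
have PL N : (1 < N)%N ->
    fine (P [set t | N%:R `^ e * N%:R `^ (- theta) < separation (x t) N])
    <= large_const R b * 2 * N%:R `^ (- eta).
  move=> N1; have NR : 1 <= N%:R :> R by rewrite ler1n ltnW.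
  have N0 : 0 < N%:R :> R by rewrite (lt_le_trans ltr01).
  apply: le_trans (Pr_separation_large hd hb hcop piP N1 (powR_gt0 e N0)) _.
  rewrite -mulrA ler_wpM2l //; first by rewrite ltW // large_const_gt0.
  rewrite mulr_natl mulr2n; apply: lerD.
    by rewrite ler_powR // lerN2 /eta ge_min lexx.
  rewrite powRXn -powRN ler_powR // lerN2 /eta ge_min.
  by rewrite [e * _]mulrC lexx orbT.
move: small {large mL PL}(large mL PL); apply: filterS2 => t [i1 h1] [i2 h2].
apply: (@dyadic_bounds R (fun N => separation (x t) N) theta e (maxn 1 (maxn i1
  i2))) => //.
  by move=> N N' N1 NN; exact: separation_decr.
move=> i; rewrite !geq_max => /and3P[i0 ii1 ii2].
apply/andP; split; first by rewrite leNgt; apply/negP; exact: h1.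
rewrite leNgt; apply/negP => h; apply: (h2 i ii2) => /=; move: h.
rewrite -powRD 1?addrC //; apply/implyP => _.
by rewrite pnatr_eq0 -lt0n expn_gt0.
Qed.

(** All exponents at once, which is what logarithmic limits require. *)
Lemma ae_separation_powers :
  {ae P, forall t, forall p : nat, \forall N \near \oo,
    (2 `^ (theta + theta))^-1 * N%:R `^ (- theta - theta / p.+1%:R)
      <= separation (x t) N
      <= 2 `^ (theta + theta) * N%:R `^ (- theta + theta / p.+1%:R)}.
Proof.
apply: ae_foralln => p; apply: ae_separation_bounds.
  by rewrite divr_gt0.
by rewrite ler_pdivrMr // ler_peMr ?(ltW theta0) // ler1n.
Qed.

Lemma covering_radius_order t N : (0 < N)%N ->
  1 / 4 * N%:R `^ (- (1 / d%:R)) <= covering_radius (x t) N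
    <= (\sum_j b j)%:R * N%:R `^ (- (1 / d%:R)).
Proof.
move=> N0; have NR : 1 <= N%:R :> R by rewrite ler1n.
have y1 : 1 <= N%:R `^ (1 / d%:R) :> R.
  by rewrite -[X in X <= _](powRr0 (N%:R : R)) ler_powR // divr_ge0.
have yd : (N%:R `^ (1 / d%:R)) ^+ d = N%:R :> R.
  by rewrite powRXn divfK ?gt_eqF // powRr1.
have := covering_radius_bounds hb hcop pi t hd N0 y1 yd.
by rewrite powRN invfM [1 / 4]div1r.
Qed.

End AlmostSure.

(** * Events on extended real ratios *)

Section RatioEvents.
Context (R : realType).

Lemma lt_abse_div (a c s : R) : 0 < a -> 0 < c -> 0 <= s ->
  (c%:E < `|a%:E / s%:E|)%E = (s < a / c).
Proof.
move=> a0 c0 s0; rewrite inver; case: eqP => [->|/eqP ne].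
  by rewrite gt0_muley ?lte_fin // divr_gt0 // ltry.
have {ne}s0' : 0 < s by rewrite lt_neqAle eq_sym ne.
rewrite -EFinM abse_EFin lte_fin ger0_norm ?divr_ge0 ?(ltW a0) //.
by rewrite !ltr_pdivlMr // mulrC.
Qed.

Context (d : nat) (x : nat -> 'rV[R]_d) (N : nat).
Hypothesis h0 : 0 < covering_radius x N.

Lemma lt_abse_mesh_ratio (c : R) : 0 < c ->
  (c%:E < `|mesh_ratio x N|)%E =
  (separation x N < 2 * covering_radius x N / c).
Proof.
move=> c0; have s0 := separation_ge0 x N; rewrite /mesh_ratio.
case: eqP => [->|/eqP ne].
  by rewrite divr_gt0 ?mulr_gt0 // ltry.
have {ne}s0' : 0 < separation x N by rewrite lt_neqAle eq_sym ne.
rewrite abse_EFin lte_fin ger0_norm ?divr_ge0 ?mulr_ge0 ?(ltW h0) //.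
by rewrite !ltr_pdivlMr // mulrC.
Qed.

Lemma lt_abse_div_mesh_ratio (a c : R) : 0 < a -> 0 < c ->
  (c%:E < `|a%:E / mesh_ratio x N|)%E =
  (2 * covering_radius x N * c / a < separation x N).
Proof.
move=> a0 c0; have s0 := separation_ge0 x N; rewrite /mesh_ratio.
have r0 : 0 < 2 * covering_radius x N * c / a by rewrite divr_gt0 ?mulr_gt0.
case: eqP => [->|/eqP ne].
  rewrite invey mule0 abse0 lte_fin.
  by rewrite [RHS]ltNge (ltW r0) ltNge (ltW c0).
have {ne}s0' : 0 < separation x N by rewrite lt_neqAle eq_sym ne.
have q0 : 0 < 2 * covering_radius x N / separation x N by rewrite divr_gt0
  ?mulr_gt0.
rewrite inver gt_eqF // -EFinM abse_EFin lte_fin ger0_norm; last first.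
  by rewrite mulr_ge0 ?invr_ge0 ?ltW.
rewrite ltr_pdivlMr // [RHS]ltr_pdivrMr // mulrCA mulrA ltr_pdivrMr //.
by rewrite [X in _ = (_ < X)]mulrC.
Qed.

End RatioEvents.

Section Assembly.
Context (R : realType) (d : nat) (hd : (0 < d)%N) (b : 'I_d -> nat)
  (hb : forall j, (1 < b j)%N)
  (hcop : forall i j, i != j -> coprime (b i) (b j)).

Local Notation theta := (3 / (2 * d%:R) : R).
Local Notation lambda := ((d%:R - 1) / (2 * d%:R) : R).

Let dR : 0 < d%:R :> R. Proof. by rewrite ltr0n. Qed.

Let K1 : R := small_const R b.
Let K2 : R := large_const R b.
Let K10 : 0 < K1. Proof. exact: small_const_gt0. Qed.
Let K20 : 0 < K2. Proof. exact: large_const_gt0. Qed.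

Let c2 : R := (\sum_j b j)%:R.

Let c20 : 0 < c2.
Proof. by rewrite ltr0n (bigD1 (Ordinal hd)) //= addn_gt0 ltnW. Qed.

(** Deviation factor and starting index for which both tail bounds are at most
    eps. *)
Definition tail_factor (eps : R) : R := 1 + K1 / eps + 2 * K2 / eps.
Definition tail_index (eps : R) : nat :=
  maxn 2 (Num.bound ((2 * K2 / eps) ^+ d)).
(** The mesh ratio brings in the constants 1 / 4 and c2 of the covering
    radius. *)
Definition tail_const (eps : R) : R := tail_factor eps * (3 + 2 * c2).

Section Fixed.
Context (disp : measure_display) (T : measurableType disp)
  (P : probability T R) (pi : forall j, seq 'I_(b j) -> T -> {perm 'I_(b j)})
  (piP : owen_permutations P pi).

Local Notation x := (scrambled_halton R hb pi).

Section OneEps.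
Variables (eps : R) (N : nat).
Hypotheses (eps0 : 0 < eps) (MN : (tail_index eps <= N)%N).

Let N1 : (1 < N)%N. Proof. by apply: leq_trans MN; rewrite leq_max. Qed.
Let NR : 0 < N%:R :> R. Proof. by rewrite ltr0n ltnW. Qed.
Let lN : 0 < ln N%:R :> R. Proof. by rewrite ln_gt0 // ltr1n. Qed.

Let u_ge : [/\ 1 <= tail_factor eps, K1 / tail_factor eps <= eps
  & K2 / tail_factor eps <= eps / 2].
Proof.
have k1 : 0 < K1 / eps by rewrite divr_gt0.
have k2 : 0 < 2 * K2 / eps by rewrite divr_gt0 // mulr_gt0.
have u1 : 1 <= tail_factor eps by rewrite /tail_factor; lra.
have u0 : 0 < tail_factor eps by apply: lt_le_trans u1.
split=> //.
  by rewrite ler_pdivrMr // mulrC -ler_pdivrMr // /tail_factor; lra.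
rewrite ler_pdivrMr // mulrAC ler_pdivlMr // [eps * _]mulrC [K2 * 2]mulrC.
by rewrite -ler_pdivrMr // /tail_factor; lra.
Qed.

Lemma measurable_sep_lt (f : T -> R) : measurable_fun setT f ->
  measurable [set t | separation (x t) N < f t].
Proof.
move=> mf; rewrite -[X in measurable X]setTI.
exact: (measurable_fun_ltr (measurable_separation hb piP N1) mf).
Qed.

Lemma measurable_sep_gt (f : T -> R) : measurable_fun setT f ->
  measurable [set t | f t < separation (x t) N].
Proof.
move=> mf; rewrite -[X in measurable X]setTI.
exact: (measurable_fun_ltr mf (measurable_separation hb piP N1)).
Qed.

Lemma P_separation_small (f : T -> R) w : tail_factor eps <= w ->
  measurable_fun setT f ->
  (forall t, f t <= N%:R `^ (- theta) * ln N%:R `^ (- lambda) / w) ->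
  (P [set t | (separation (x t) N < f t)%R] <= eps%:E)%E.
Proof.
move=> uw mf hf; have [u1 uK _] := u_ge.
have mf' := measurable_sep_lt mf.
rewrite PrE // lee_fin.
apply: (@le_trans _ _ (fine (P [set t | separation (x t) N <
    N%:R `^ (- theta) * ln N%:R `^ (- lambda) / w]))).
  apply: Pr_le => //; first exact: measurable_sep_lt.
  by move=> t /= /lt_le_trans; apply.
apply: le_trans (Pr_separation_small hd hb hcop piP N1 (le_trans u1 uw)) _.
apply: le_trans uK; rewrite ler_pM2l // lef_pV2 ?posrE //;
  by rewrite ?(lt_le_trans _ uw) // (lt_le_trans _ u1).
Qed.

Lemma P_separation_large (f : T -> R) w : tail_factor eps <= w ->
  measurable_fun setT f ->
  (forall t, w * N%:R `^ (- theta) <= f t) ->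
  (P [set t | (f t < separation (x t) N)%R] <= eps%:E)%E.
Proof.
move=> uw mf hf; have [u1 _ uK] := u_ge.
have u0 : 0 < tail_factor eps by apply: lt_le_trans u1.
have w0 : 0 < w by apply: lt_le_trans uw.
rewrite PrE; last exact: measurable_sep_gt.
rewrite lee_fin.
apply: (@le_trans _ _ (fine (P [set t | w * N%:R `^ (- theta) < separation (x t)
  N]))).
  apply: Pr_le => //; [exact: measurable_sep_gt|exact: measurable_sep_gt|].
  by move=> t /=; apply: le_lt_trans.
apply: le_trans (Pr_separation_large hd hb hcop piP N1 w0) _.
have k2 : 0 < 2 * K2 / eps by rewrite divr_gt0 // mulr_gt0.
have h1 : K2 * N%:R `^ (- (1 / d%:R)) <= eps / 2.
  have kN : 2 * K2 / eps <= N%:R `^ (1 / d%:R).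
    have -> : 2 * K2 / eps = ((2 * K2 / eps) ^+ d) `^ (1 / d%:R).
      rewrite -powR_mulrn ?(ltW k2) // -powRrM [d%:R * _]mulrC divfK ?gt_eqF //.
      by rewrite powRr1 // ltW.
    apply: ge0_ler_powR; rewrite ?nnegrE ?exprn_ge0 ?(ltW k2) ?divr_ge0 //.
    apply: le_trans (ltW (archi_boundP _)) _; first by rewrite exprn_ge0 // ltW.
    by rewrite ler_nat; apply: leq_trans MN; rewrite leq_max leqnn orbT.
  rewrite powRN ler_pdivrMr ?powR_gt0 // mulrAC ler_pdivlMr // mulrC.
  by rewrite mulrC [K2 * 2]mulrC [eps * _]mulrC -ler_pdivrMr.
have h2 : K2 * (w ^+ 2)^-1 <= eps / 2.
  apply: le_trans uK; rewrite ler_pM2l // lef_pV2 ?posrE ?exprn_gt0 //.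
  apply: (le_trans uw); rewrite expr2 ler_peMr ?(ltW w0) //.
  exact: le_trans uw.
by rewrite mulrDr [X in _ <= X](splitr eps); exact: lerD.
Qed.

End OneEps.

Let theta0 : 0 < theta. Proof. by rewrite divr_gt0 // mulr_gt0. Qed.

Lemma ae_log_separation :
  {ae P, forall t : T, (lne (separation (x t) N)%:E / (ln N%:R)%:E)%E
     @[N --> \oo] --> (- theta)%:E}.
Proof.
move: (ae_separation_powers hd hb hcop piP); apply: filterS => t ht.
apply: (log_limit theta0) => p; exists (2 `^ (theta + theta)).
  by rewrite powR_gt0.
exact: ht.
Qed.

(** The exponent is - 1 / d + theta = 1 / (2 d). *)
Lemma mesh_ratio_powers t :
  (forall p : nat, \forall N \near \oo,
    (2 `^ (theta + theta))^-1 * N%:R `^ (- theta - theta / p.+1%:R)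
      <= separation (x t) N
      <= 2 `^ (theta + theta) * N%:R `^ (- theta + theta / p.+1%:R)) ->
  exists2 C : R, 0 < C & forall p : nat, \forall N \near \oo,
    C^-1 * N%:R `^ (1 / (2 * d%:R) - theta / p.+1%:R)
      <= 2 * covering_radius (x t) N / separation (x t) N
      <= C * N%:R `^ (1 / (2 * d%:R) + theta / p.+1%:R).
Proof.
set D := 2 `^ (theta + theta) => ht.
have D0 : 0 < D by rewrite powR_gt0.
exists (D * (2 + 2 * c2)); first by rewrite mulr_gt0 // addr_gt0 // mulr_gt0.
move=> p; near=> N.
have N0 : (0 < N)%N by near: N; exact: nbhs_infty_gt.
have NR : 0 < N%:R :> R by rewrite ltr0n.
have pw s : 0 < N%:R `^ s :> R by rewrite powR_gt0.
set e := theta / p.+1%:R.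
have /andP[lo up] : D^-1 * N%:R `^ (- theta - e)
      <= separation (x t) N <= D * N%:R `^ (- theta + e) by near: N; exact: ht.
have s0 : 0 < separation (x t) N.
  by apply: lt_le_trans lo; rewrite mulr_gt0 // invr_gt0.
have /andP[hlo hup] := covering_radius_order R hd hb hcop pi t N0.
have E s : N%:R `^ (1 / (2 * d%:R) + s) * N%:R `^ (- theta - s) =
    N%:R `^ (- (1 / d%:R)) :> R.
  rewrite -powRD ?(gt_eqF NR) ?implybT //; congr (_ `^ _).
  by field; rewrite gt_eqF.
apply/andP; split.
  rewrite ler_pdivlMr //.
  apply: (@le_trans _ _ (2 * (1 / 4 * N%:R `^ (- (1 / d%:R))))); last first.
    by rewrite ler_pM2l.
  apply: (@le_trans _ _ ((D * (2 + 2 * c2))^-1 * N%:R `^ (1 / (2 * d%:R) - e) *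
      (D * N%:R `^ (- theta + e)))).
    by rewrite ler_wpM2l // mulr_ge0 ?invr_ge0 ?(ltW (pw _)) // mulr_ge0 ?(ltW
      D0) // addr_ge0 ?mulr_ge0 ?(ltW c20).
  have := E (- e); rewrite opprK => Ee.
  have -> : (D * (2 + 2 * c2))^-1 * N%:R `^ (1 / (2 * d%:R) - e) *
      (D * N%:R `^ (- theta + e)) = (2 + 2 * c2)^-1 * N%:R `^ (- (1 / d%:R)).
    rewrite -Ee; field; rewrite (gt_eqF D0) andbT.
    by rewrite gt_eqF // addr_gt0 // mulr_gt0.
  rewrite mulrA ler_pM2r // (_ : 2 * (1 / 4) = 2^-1); last by field.
  by rewrite lef_pV2 ?posrE // ?addr_gt0 ?mulr_gt0 // lerDl mulr_ge0 // ltW.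
rewrite ler_pdivrMr //.
apply: (@le_trans _ _ (2 * (c2 * N%:R `^ (- (1 / d%:R))))); first by rewrite
  ler_pM2l.
apply: (@le_trans _ _ (D * (2 + 2 * c2) * N%:R `^ (1 / (2 * d%:R) + e) *
    (D^-1 * N%:R `^ (- theta - e)))); last first.
  by rewrite ler_wpM2l // mulr_ge0 ?(ltW (pw _)) // mulr_ge0 ?(ltW D0) //
    addr_ge0 ?mulr_ge0 ?(ltW c20).
have -> : D * (2 + 2 * c2) * N%:R `^ (1 / (2 * d%:R) + e) *
    (D^-1 * N%:R `^ (- theta - e)) = (2 + 2 * c2) * N%:R `^ (- (1 / d%:R)).
  by rewrite -(E e); field; rewrite (gt_eqF D0).
by rewrite mulrA ler_pM2r // lerDr.
Unshelve. all: end_near. Qed.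

Lemma mesh_ratioE t N : separation (x t) N != 0 ->
  mesh_ratio (x t) N = (2 * covering_radius (x t) N / separation (x t) N)%:E.
Proof. by rewrite /mesh_ratio => /negPf ->. Qed.

Lemma near_separation_neq0 t (C : R) : 0 < C ->
  (\forall N \near \oo,
    C^-1 * N%:R `^ (1 / (2 * d%:R) - theta / 1%:R)
      <= 2 * covering_radius (x t) N / separation (x t) N
      <= C * N%:R `^ (1 / (2 * d%:R) + theta / 1%:R)) ->
  \forall N \near \oo, separation (x t) N != 0.
Proof.
move=> C0 h; near=> N.
have /andP[lo _] : C^-1 * N%:R `^ (1 / (2 * d%:R) - theta / 1%:R)
      <= 2 * covering_radius (x t) N / separation (x t) N
      <= C * N%:R `^ (1 / (2 * d%:R) + theta / 1%:R) by near: N.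
have N0 : (0 < N)%N by near: N; exact: nbhs_infty_gt.
apply/eqP => s0; move: lo; rewrite s0 invr0 mulr0 leNgt => /negP; apply.
by rewrite mulr_gt0 ?invr_gt0 // powR_gt0 // ltr0n.
Unshelve. all: end_near. Qed.

Lemma ae_log_mesh_ratio :
  {ae P, forall t : T, (lne (mesh_ratio (x t) N) / (ln N%:R)%:E)%E
     @[N --> \oo] --> (1 / (2 * d%:R))%:E}.
Proof.
move: (ae_separation_powers hd hb hcop piP); apply: filterS => t ht.
have [C C0 hC] := mesh_ratio_powers ht.
apply: (@cvg_trans _ ((lne (2 * covering_radius (x t) N / separation (x t) N)%:E
   / (ln N%:R)%:E)%E @[N --> \oo])); last first.
  by apply: (log_limit theta0) => p; exists C => //; exact: hC.
apply: near_eq_cvg.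
move: (near_separation_neq0 C0 (hC 0%N)).
by apply: filterS => N s0; rewrite mesh_ratioE.
Qed.

(** The mesh ratio exceeds any bound since its exponent remains positive after
    subtracting theta / 4. *)
Lemma ae_not_quasi_uniform : {ae P, forall t : T, ~ quasi_uniform (x t)}.
Proof.
move: (ae_separation_powers hd hb hcop piP); apply: filterS => t ht qu.
have [C C0 hC] := mesh_ratio_powers ht.
have [M' hM] : exists M' : R, forall N, (2 <= N)%N -> (mesh_ratio (x t) N <=
  M'%:E)%E.
  move: qu; rewrite /quasi_uniform; set S := ereal_sup _ => qu.
  have hS N : (2 <= N)%N -> (mesh_ratio (x t) N <= S)%E.
    by move=> N2; apply: ereal_sup_ubound; exists N.
  case: S qu hS => [r|//|] _ hS; first by exists r.
  by exists 0 => N N2; apply: le_trans (hS N N2) _; rewrite leNye.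
pose s : R := 1 / (2 * d%:R) - theta / 4%:R.
have s0 : 0 < s.
  have -> : s = 1 / (8 * d%:R) by rewrite /s; field; rewrite gt_eqF.
  by rewrite divr_gt0 // mulr_gt0.
pose A := C * (`|M'| + 1).
have A0 : 0 < A by rewrite mulr_gt0 // ltr_pwDr.
suff : \forall N \near \oo, False.
  by move=> [n _ /(_ n (leqnn n))].
have near0 := near_separation_neq0 C0 (hC 0%N).
near=> N.
have /andP[lo _] : C^-1 * N%:R `^ s
      <= 2 * covering_radius (x t) N / separation (x t) N
      <= C * N%:R `^ (1 / (2 * d%:R) + theta / 4%:R) by near: N; exact: (hC
        3%N).
have sN : separation (x t) N != 0 by near: N.
have N2 : (2 <= N)%N by near: N; exact: nbhs_infty_ge.
have := hM N N2; rewrite mesh_ratioE // lee_fin => /(le_trans lo).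
rewrite mulrC ler_pdivrMr //; apply/negP; rewrite -ltNge.
apply: (@lt_le_trans _ _ A).
  rewrite /A mulrC ltr_pM2l //; apply: le_lt_trans (ler_norm _) _.
  by rewrite ltrDl.
have -> : A = (A `^ s^-1) `^ s by rewrite -powRrM mulVf ?gt_eqF // powRr1 //
  ltW.
apply: ge0_ler_powR; rewrite ?nnegrE ?powR_ge0 ?(ltW s0) //.
apply: le_trans (ltW (archi_boundP (powR_ge0 _ _))) _.
by rewrite ler_nat; near: N; exact: nbhs_infty_ge.
Unshelve. all: end_near. Qed.

Section Orders.
Variables (eps : R) (N : nat).
Hypotheses (eps0 : 0 < eps) (MN : (tail_index eps <= N)%N).

Let N1 : (1 < N)%N. Proof. by apply: leq_trans MN; rewrite leq_max. Qed.
Let NR : 0 < N%:R :> R. Proof. by rewrite ltr0n ltnW. Qed.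
Let lN : 0 < ln N%:R :> R. Proof. by rewrite ln_gt0 // ltr1n. Qed.
Let pN s : 0 < N%:R `^ s :> R. Proof. exact: powR_gt0. Qed.
Let plN s : 0 < ln N%:R `^ s :> R. Proof. exact: powR_gt0. Qed.

Let u0 : 0 < tail_factor eps.
Proof.
have k1 : 0 < K1 / eps by rewrite divr_gt0.
have k2 : 0 < 2 * K2 / eps by rewrite divr_gt0 // mulr_gt0.
by rewrite /tail_factor; lra.
Qed.

Lemma tail_const_gt0 : 0 < tail_const eps.
Proof. by rewrite mulr_gt0 // addr_gt0 // mulr_gt0. Qed.

Let h_bounds t := covering_radius_order R hd hb hcop pi t (ltnW N1).

Let h0 t : 0 < covering_radius (x t) N.
Proof.
by have /andP[+ _] := h_bounds t; apply: lt_le_trans; rewrite mulr_gt0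
  ?divr_gt0.
Qed.

Let mh : measurable_fun setT (fun t => covering_radius (x t) N).
Proof. exact: (measurable_covering_radius hb piP (ltnW N1)). Qed.

Let uC : tail_factor eps <= tail_const eps.
Proof. by rewrite /tail_const ler_peMr ?(ltW u0) //; have := c20; lra. Qed.

Lemma separation_omega : (P [set t | (tail_const eps * 1)%:E <
  `|(N%:R `^ (- theta) * ln N%:R `^ (- lambda))%:E /
    (separation (x t) N)%:E| ] <= eps%:E)%E.
Proof.
rewrite (_ : [set t | _] = [set t | separation (x t) N <
    N%:R `^ (- theta) * ln N%:R `^ (- lambda) / tail_const eps]).
  exact: (@P_separation_small eps N _ _ _ (tail_const eps)).
apply/seteqP; split => t /=; rewrite mulr1 lt_abse_div ?separation_ge0 //;
  by rewrite ?tail_const_gt0 ?mulr_gt0.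
Qed.

Lemma separation_O : (P [set t | (tail_const eps * N%:R `^ (- theta))%:E <
  `|(separation (x t) N)%:E| ] <= eps%:E)%E.
Proof.
rewrite (_ : [set t | _] =
    [set t | tail_const eps * N%:R `^ (- theta) < separation (x t) N]).
  exact: (@P_separation_large eps N _ _ _ (tail_const eps)).
by apply/seteqP; split => t /=; rewrite lte_fin ger0_norm ?separation_ge0.
Qed.

Lemma mesh_ratio_omega : (P [set t | (tail_const eps * 1)%:E <
  `|(N%:R `^ (1 / (2 * d%:R)))%:E / mesh_ratio (x t) N| ] <= eps%:E)%E.
Proof.
rewrite (_ : [set t | _] = [set t | 2 * covering_radius (x t) N * tail_const eps
  /
    N%:R `^ (1 / (2 * d%:R)) < separation (x t) N]); last first.
  by apply/seteqP; split => t /=; rewrite mulr1 lt_abse_div_mesh_ratio //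
    tail_const_gt0.
apply: (@P_separation_large eps N _ _ _ (tail_const eps / 2)) => //.
- by rewrite ler_pdivlMr // /tail_const ler_pM2l //; have := c20; lra.
- apply: measurable_funM => //; apply: measurable_funM => //.
  exact: measurable_funM.
move=> t; have /andP[hl _] := h_bounds t.
rewrite ler_pdivlMr //.
have -> : tail_const eps / 2 * N%:R `^ (- theta) * N%:R `^ (1 / (2 * d%:R)) =
    2 * (1 / 4 * N%:R `^ (- (1 / d%:R))) * tail_const eps.
  rewrite -mulrA -powRD ?(gt_eqF NR) ?implybT //.
  rewrite (_ : - theta + 1 / (2 * d%:R) = - (1 / d%:R)); last first.
    by field; rewrite gt_eqF.
  by field.
by rewrite ler_pM2r ?tail_const_gt0 // ler_pM2l.
Qed.

Lemma mesh_ratio_O : (P [set t |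
  (tail_const eps * (N%:R `^ (1 / (2 * d%:R)) * ln N%:R `^ lambda))%:E <
  `|mesh_ratio (x t) N| ] <= eps%:E)%E.
Proof.
have c0 : 0 < tail_const eps * (N%:R `^ (1 / (2 * d%:R)) * ln N%:R `^ lambda).
  by rewrite mulr_gt0 ?tail_const_gt0 // mulr_gt0.
rewrite (_ : [set t | _] = [set t | separation (x t) N <
    2 * covering_radius (x t) N /
    (tail_const eps * (N%:R `^ (1 / (2 * d%:R)) * ln N%:R `^ lambda))]); last
      first.
  by apply/seteqP; split => t /=; rewrite lt_abse_mesh_ratio.
apply: (@P_separation_small eps N _ _ _ (tail_const eps / (2 * c2))) => //.
- rewrite ler_pdivlMr ?mulr_gt0 // /tail_const ler_pM2l //; lra.
- by apply: measurable_funM => //; exact: measurable_funM.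
move=> t; have /andP[_ hu] := h_bounds t.
rewrite ler_pdivrMr //.
apply: (@le_trans _ _ (2 * (c2 * N%:R `^ (- (1 / d%:R))))); first by rewrite
  ler_pM2l.
have -> : N%:R `^ (- (1 / d%:R)) =
    N%:R `^ (- theta) * N%:R `^ (1 / (2 * d%:R)) :> R.
  rewrite -powRD ?(gt_eqF NR) ?implybT //; congr (_ `^ _).
  by field; rewrite gt_eqF.
rewrite powRN [ln _ `^ (- _)]powRN le_eqVlt; apply/orP; left; apply/eqP.
field; rewrite !gt_eqF ?tail_const_gt0 //.
Qed.

End Orders.

End Fixed.

End Assembly.

Unset Implicit Arguments.
Set Strict Implicit.

Theorem mainTheorem13 (R : realType) (d : nat) (hd : (1 <= d)%N)
    (b : 'I_d -> nat) (hb : forall j, (2 <= b j)%N)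
    (hcop : forall i j, i != j -> coprime (b i) (b j)) :
  exists (C : R -> R) (M : R -> nat) (c1 c2 : R),
    [/\ 0 < c1, 0 < c2 &
    forall (disp : measure_display) (T : measurableType disp)
      (P : probability T R)
      (pi : forall j, seq 'I_(b j) -> T -> {perm 'I_(b j)}),
    owen_permutations P pi ->
    let x : T -> nat -> 'rV[R]_d := scrambled_halton R hb pi in
    let sepN (N : nat) (t : T) : \bar R := (separation (x t) N)%:E in
    let rhoN (N : nat) (t : T) : \bar R := mesh_ratio (x t) N in
    (bigOmegaP_with C M P sepN (fun N =>
        N%:R `^ (- (3 / (2 * d%:R))) *
        ln N%:R `^ (- ((d%:R - 1) / (2 * d%:R)))) /\
     bigOP_with C M P sepN (fun N => N%:R `^ (- (3 / (2 * d%:R))))) /\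
    (forall (t : T) (N : nat), (2 <= N)%N ->
        c1 * N%:R `^ (- (1 / d%:R)) <= covering_radius (x t) N
          <= c2 * N%:R `^ (- (1 / d%:R))) /\
    (bigOmegaP_with C M P rhoN (fun N => N%:R `^ (1 / (2 * d%:R))) /\
     bigOP_with C M P rhoN (fun N =>
        N%:R `^ (1 / (2 * d%:R)) *
        ln N%:R `^ ((d%:R - 1) / (2 * d%:R)))) /\
    {ae P, forall t : T,
        (lne (sepN N t) / (ln N%:R)%:E)%E @[N --> \oo]
          --> (- (3 / (2 * d%:R)))%:E} /\
    {ae P, forall t : T,
        (lne (rhoN N t) / (ln N%:R)%:E)%E @[N --> \oo]
          --> (1 / (2 * d%:R))%:E} /\
    {ae P, forall t : T, ~ quasi_uniform (x t)}].
Proof.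
exists (tail_const b), (tail_index b), (1 / 4), (\sum_j b j)%:R; split.
- by [].
- by rewrite ltr0n (bigD1 (Ordinal hd)) //= addn_gt0 ltnW.
move=> disp T P pi piP x sepN rhoN.
have C0 (eps : R) : 0 < eps -> 0 < tail_const b eps.
  exact: tail_const_gt0.
split; first split.
- by move=> eps eps0; split; [exact: C0|move=> N MN; exact: separation_omega].
- by move=> eps eps0; split; [exact: C0|move=> N MN; exact: separation_O].
split.
  by move=> t N N2; exact: (covering_radius_order R hd hb hcop pi t (ltnW N2)).
split; first split.
- by move=> eps eps0; split; [exact: C0|move=> N MN; exact: mesh_ratio_omega].
- by move=> eps eps0; split; [exact: C0|move=> N MN; exact: mesh_ratio_O].
split; first exact: ae_log_separation.
split; first exact: ae_log_mesh_ratio.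
exact: ae_not_quasi_uniform.
Qed.
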